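(* Let $H$ be a finite $2$-group. Then $H$ is the holonomy group of some flat manifold $M$. Further, the dimension of $M$ may be chosen to be $n(n-1)/2$, where $n\geq 3$ is an (arbitrary) integer for which $H$ embeds in the symmetric group $S_n$, and the fundamental group of $M$ is isomorphic to a subgroup of $B_n/[P_n,P_n]$.
   Context: $B_n$ is the Artin braid group with generators $\sigma_1,\ldots,\sigma_{n-1}$ and relations $\sigma_i\sigma_j=\sigma_j\sigma_i$ for $|i-j|\geq 2$, and $\sigma_{i+1}\sigma_i\sigma_{i+1}=\sigma_i\sigma_{i+1}\sigma_i$ for $1\leq i\leq n-2$. $P_n$ is the pure braid group, i.e. the kernel of the homomorphism $\sigma\colon B_n\to S_n$ with $\sigma(\sigma_i)=(i,i+1)$, and $[P_n,P_n]$ is its commutator subgroup. A flat manifold is a closed Riemannian manifold with zero curvature at every point. Its fundamental group $\Pi$ is a Bieberbach group (torsion-free crystallographic group): there is a short exact sequence $0\to\mathbb{Z}^d\to\Pi\to\Phi\to 1$, where $d$ is the dimension of the manifold, $\Phi$ is finite and the action of $\Phi$ on $\mathbb{Z}^d$ induced by conjugation is faithful. The holonomy group of the manifold is (isomorphic to) $\Phi$. *)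

(* Defs.v *)
From HB Require Import structures.
From mathcomp Require Import all_boot all_order all_algebra all_fingroup all_solvable.
From mathcomp Require Import zify.
From mathcomp Require Import all_classical all_reals all_analysis.
(* Imported last because fingroup also exports a [repr]. *)
From mathcomp Require Import generic_quotient.
Import numFieldNormedType.Exports.

Set Implicit Arguments.
Unset Strict Implicit.
Unset Printing Implicit Defensive.

Import Order.TTheory GRing.Theory Num.Theory.

Local Open Scope classical_set_scope.
Local Open Scope group_scope.
Local Open Scope quotient_scope.
Local Open Scope ring_scope.

Section Presentation.
Local Open Scope group_scope.

Variables (X : choiceType) (rels : seq (X * bool) -> seq (X * bool) -> Prop).

(* A letter (x, true) stands for x and (x, false) for its inverse. *)
Inductive word_eq : seq (X * bool) -> seq (X * bool) -> Prop :=
| word_eq_refl u : word_eq u u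
| word_eq_sym u v : word_eq u v -> word_eq v u
| word_eq_trans v u w : word_eq u v -> word_eq v w -> word_eq u w
| word_eq_cat u u' v v' :
    word_eq u u' -> word_eq v v' -> word_eq (u ++ v) (u' ++ v')
| word_eq_cancel x b : word_eq [:: (x, b); (x, ~~ b)] [::]
| word_eq_rel u v : rels u v -> word_eq u v.

Definition word_eqb u v := `[< word_eq u v >].

Fact word_eqb_refl : reflexive word_eqb.
Proof. by move=> u; apply/asboolP; constructor. Qed.

Fact word_eqb_sym : symmetric word_eqb.
Proof.
by move=> u v; apply/idP/idP => /asboolP uv; apply/asboolP; exact: word_eq_sym.
Qed.

Fact word_eqb_trans : transitive word_eqb.
Proof.
move=> v u w /asboolP uv /asboolP vw; apply/asboolP.
exact: word_eq_trans uv vw.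
Qed.

Canonical word_equiv := EquivRel word_eqb word_eqb_refl word_eqb_sym word_eqb_trans.

Definition presented := {eq_quot word_equiv}.
HB.instance Definition _ := Choice.on presented.
HB.instance Definition _ := Quotient.on presented.

Definition word_class (u : seq (X * bool)) : presented := \pi_presented u.

Lemma word_classP u v : word_class u = word_class v <-> word_eq u v.
Proof.
split=> [/eqmodP /asboolP //|uv]; apply/eqmodP; exact/asboolP.
Qed.

Lemma word_repr u : word_eq (repr (word_class u)) u.
Proof. by apply/word_classP; rewrite /word_class reprK. Qed.

Definition word_inv (u : seq (X * bool)) := rev [seq (a.1, ~~ a.2) | a <- u].

Lemma word_inv_cat u v : word_inv (u ++ v) = word_inv v ++ word_inv u.
Proof. by rewrite /word_inv map_cat rev_cat. Qed.

Lemma word_invK : involutive word_inv.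
Proof.
move=> u; rewrite /word_inv map_rev revK -map_comp -[RHS]map_id.
by apply: eq_map => -[x b] /=; rewrite negbK.
Qed.

Lemma word_eq_mulV u : word_eq (u ++ word_inv u) [::].
Proof.
elim: u => [|[x b] u IHu]; first exact: word_eq_refl.
rewrite -cat1s word_inv_cat.
apply: word_eq_trans (word_eq_cancel x b).
rewrite -[[:: (x, b); (x, ~~ b)]]/([:: (x, b)] ++ [::] ++ [:: (x, ~~ b)]).
rewrite -catA; apply: word_eq_cat; first exact: word_eq_refl.
rewrite catA; apply: word_eq_cat => //; exact: word_eq_refl.
Qed.

Lemma word_eq_Vmul u : word_eq (word_inv u ++ u) [::].
Proof. by rewrite -{2}[u]word_invK; exact: word_eq_mulV. Qed.

Definition presented_one := word_class [::].
Definition presented_mul (x y : presented) := word_class (repr x ++ repr y).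
Definition presented_inv (x : presented) := word_class (word_inv (repr x)).

Lemma presented_mulE u v :
  presented_mul (word_class u) (word_class v) = word_class (u ++ v).
Proof. by apply/word_classP; apply: word_eq_cat; exact: word_repr. Qed.

Lemma word_class_repr (x : presented) : word_class (repr x) = x.
Proof. exact: reprK. Qed.

Fact presented_mulA : associative presented_mul.
Proof.
move=> x y z; rewrite -[x]word_class_repr -[y]word_class_repr.
by rewrite -[z]word_class_repr !presented_mulE catA.
Qed.

Fact presented_mul1 : left_id presented_one presented_mul.
Proof. by move=> x; rewrite -[x]word_class_repr presented_mulE. Qed.

Fact presented_1mul : right_id presented_one presented_mul.
Proof. by move=> x; rewrite -[x]word_class_repr presented_mulE cats0. Qed.

Fact presented_mulV : left_inverse presented_one presented_inv presented_mul.
Proof.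
move=> x; rewrite -{2}[x]word_class_repr presented_mulE.
exact/word_classP/word_eq_Vmul.
Qed.

Fact presented_Vmul : right_inverse presented_one presented_inv presented_mul.
Proof.
move=> x; rewrite -{1}[x]word_class_repr presented_mulE.
exact/word_classP/word_eq_mulV.
Qed.

HB.instance Definition _ := isGroup.Build presented presented_mulA
  presented_mul1 presented_1mul presented_mulV presented_Vmul.

Section Lift.
Variables (G : groupType) (f : X -> G).

Definition word_eval (u : seq (X * bool)) : G :=
  \prod_(a <- u) (if a.2 then f a.1 else (f a.1)^-1).

Hypothesis f_rels : forall u v, rels u v -> word_eval u = word_eval v.

Lemma word_eval_eq u v : word_eq u v -> word_eval u = word_eval v.
Proof.
elim=> //.
- by move=> ? ? ? _ -> _ ->.
- by move=> ? ? ? ? _ + _; rewrite /word_eval !big_cat /= => -> ->.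
- move=> x [] /=; rewrite /word_eval big_cons big_seq1 big_nil /=.
    exact: mulgV.
  exact: mulVg.
Qed.

Definition presented_lift of (forall u v, rels u v -> word_eval u = word_eval v)
  := fun x : presented => word_eval (repr x).

Fact presented_lift_morph : {morph presented_lift f_rels : x y / x * y}.
Proof.
move=> x y; rewrite /presented_lift (word_eval_eq (word_repr _)).
by rewrite /word_eval big_cat.
Qed.

HB.instance Definition _ :=
  isMultiplicative.Build presented G (presented_lift f_rels)
    presented_lift_morph.
End Lift.
End Presentation.

Section Quotient.
Local Open Scope group_scope.
Variable G : groupType.

Record normal_subgroup := NormalSubgroup {
  nsub :> G -> Prop;
  nsub1 : nsub 1;
  nsubM : forall x y, nsub x -> nsub y -> nsub (x * y);
  nsubV : forall x, nsub x -> nsub x^-1;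
  nsubJ : forall x y, nsub x -> nsub (x ^ y) }.

Variable N : normal_subgroup.

Definition coset_eqb x y := `[< N (x^-1 * y) >].

Fact coset_eqb_refl : reflexive coset_eqb.
Proof. by move=> x; apply/asboolP; rewrite mulVg; exact: nsub1. Qed.

Fact coset_eqb_sym : symmetric coset_eqb.
Proof.
by move=> x y; apply/idP/idP => /asboolP /nsubV; rewrite invgM invgK => ?;
  apply/asboolP.
Qed.

Fact coset_eqb_trans : transitive coset_eqb.
Proof.
move=> y x z /asboolP xy /asboolP yz; apply/asboolP.
by have := nsubM xy yz; rewrite mulgA mulgK.
Qed.

Canonical coset_equiv :=
  EquivRel coset_eqb coset_eqb_refl coset_eqb_sym coset_eqb_trans.

Definition group_quotient := {eq_quot coset_equiv}.
HB.instance Definition _ := Choice.on group_quotient.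
HB.instance Definition _ := Quotient.on group_quotient.

Definition coset_class (x : G) : group_quotient := \pi_group_quotient x.

Lemma coset_classP x y : coset_class x = coset_class y <-> N (x^-1 * y).
Proof. by split=> [/eqmodP /asboolP //|xy]; apply/eqmodP; exact/asboolP. Qed.

Lemma coset_class_repr x : coset_class (repr x) = x.
Proof. exact: reprK. Qed.

Definition quotient_one := coset_class 1.
Definition quotient_mul (x y : group_quotient) := coset_class (repr x * repr y).
Definition quotient_inv (x : group_quotient) := coset_class (repr x)^-1.

Lemma quotient_mulE x y :
  quotient_mul (coset_class x) (coset_class y) = coset_class (x * y).
Proof.
apply/coset_classP; set x' := repr _; set y' := repr _.
have Nx : N (x'^-1 * x) by apply/coset_classP; rewrite coset_class_repr.
have Ny : N (y'^-1 * y) by apply/coset_classP; rewrite coset_class_repr.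
have := nsubM (nsubJ y' Nx) Ny.
by rewrite /conjg !mulgA mulgK invgM.
Qed.

Fact quotient_mulA : associative quotient_mul.
Proof.
move=> x y z; rewrite -[x]coset_class_repr -[y]coset_class_repr.
by rewrite -[z]coset_class_repr !quotient_mulE mulgA.
Qed.

Fact quotient_mul1 : left_id quotient_one quotient_mul.
Proof. by move=> x; rewrite -[x]coset_class_repr quotient_mulE mul1g. Qed.

Fact quotient_1mul : right_id quotient_one quotient_mul.
Proof. by move=> x; rewrite -[x]coset_class_repr quotient_mulE mulg1. Qed.

Fact quotient_mulV : left_inverse quotient_one quotient_inv quotient_mul.
Proof. by move=> x; rewrite -{2}[x]coset_class_repr quotient_mulE mulVg. Qed.

Fact quotient_Vmul : right_inverse quotient_one quotient_inv quotient_mul.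
Proof. by move=> x; rewrite -{1}[x]coset_class_repr quotient_mulE mulgV. Qed.

HB.instance Definition _ := isGroup.Build group_quotient quotient_mulA
  quotient_mul1 quotient_1mul quotient_mulV quotient_Vmul.
End Quotient.

Section Subgroups.
Local Open Scope group_scope.

Inductive generated_by (G : groupType) (S : set G) : set G :=
| generated_one : generated_by S 1
| generated_incl x of S x : generated_by S x
| generated_mul x y of generated_by S x & generated_by S y : generated_by S (x * y)
| generated_inv x of generated_by S x : generated_by S x^-1.

Definition commutator_set (G : groupType) (P : set G) : set G :=
  generated_by [set z | exists x y, [/\ P x, P y & z = [~ x, y]]].

Fact commutator_setJ (G : groupType) (P : normal_subgroup G) x y :
  commutator_set P x -> commutator_set P (x ^ y).
Proof.
elim=> [|_ [u [v [Pu Pv ->]]]|u v _ Pu _ Pv|u _ Pu].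
- by rewrite conj1g; exact: generated_one.
- apply: generated_incl; exists (u ^ y), (v ^ y).
  by split; [exact: nsubJ|exact: nsubJ|rewrite conjRg].
- by rewrite conjMg; exact: generated_mul.
- by rewrite conjVg; exact: generated_inv.
Qed.

Definition commutator_subgroup (G : groupType) (P : normal_subgroup G) :
    normal_subgroup G :=
  @NormalSubgroup G (commutator_set P) (@generated_one _ _) (@generated_mul _ _)
    (@generated_inv _ _) (@commutator_setJ G P).

Section Kernel.
Variables (G K : groupType) (f : {multiplicative G -> K}).

Definition kernel_set : set G := [set x | f x = 1].

Fact kernel1 : kernel_set 1.
Proof. by apply: (@mulgI _ (f 1)); rewrite mulg1 -gmulfM mulg1. Qed.

Fact kernelM x y : kernel_set x -> kernel_set y -> kernel_set (x * y).
Proof. by rewrite /kernel_set /= gmulfM => -> ->; rewrite mulg1. Qed.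

Fact kernelV x : kernel_set x -> kernel_set x^-1.
Proof.
move=> fx; have := kernel1; rewrite /kernel_set /= -{1}(mulgV x) gmulfM.
by rewrite fx mul1g.
Qed.

Fact kernelJ x y : kernel_set x -> kernel_set (x ^ y).
Proof.
move=> fx; have := kernel1; rewrite /kernel_set /= -{1}(mulVg y) !gmulfM.
by rewrite fx mul1g.
Qed.

Definition morph_kernel : normal_subgroup G :=
  NormalSubgroup kernel1 kernelM kernelV kernelJ.
End Kernel.
End Subgroups.

Section Braid.
Local Open Scope group_scope.
Variable n : nat.

(* The Artin generator sigma_i, 1 <= i <= n - 1, is the letter i - 1 : 'I_n.-1. *)
Inductive braid_rel : seq ('I_n.-1 * bool) -> seq ('I_n.-1 * bool) -> Prop :=
| braid_far (i j : 'I_n.-1) of (i + 2 <= j)%N || (j + 2 <= i)%N :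
    braid_rel [:: (i, true); (j, true)] [:: (j, true); (i, true)]
| braid_near (i j : 'I_n.-1) of j = i.+1 :> nat :
    braid_rel [:: (j, true); (i, true); (j, true)]
              [:: (i, true); (j, true); (i, true)].

Definition braid_group := presented braid_rel.
HB.instance Definition _ := Group.on braid_group.

Fact ord_left_subproof (i : 'I_n.-1) : (i < n)%N.
Proof. exact: leq_trans (ltn_ord i) (leq_pred n). Qed.

Fact ord_right_subproof (i : 'I_n.-1) : (i.+1 < n)%N.
Proof. by case: i => i /=; case: (n). Qed.

Definition ord_left i : 'I_n := Ordinal (ord_left_subproof i).
Definition ord_right i : 'I_n := Ordinal (ord_right_subproof i).

Definition adjacent_tperm (i : 'I_n.-1) : 'S_n :=
  tperm (ord_left i) (ord_right i).

Fact adjacent_tperm_rel u v : braid_rel u v ->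
  word_eval adjacent_tperm u = word_eval adjacent_tperm v.
Proof.
have tpermJE (a b c d : 'I_n) :
    tperm a b * tperm c d * tperm a b = tperm c d ^ tperm a b.
  by rewrite /conjg tpermV mulgA.
have ord_neq (i j : 'I_n) : i != j :> nat -> i != j by [].
rewrite /word_eval; case=> [i j ij|i j ij].
  rewrite !big_cons big_nil /= !mulg1; set ti := adjacent_tperm i.
  suff {2}<- : ti ^ adjacent_tperm j = ti by rewrite conjgC mulgA.
  rewrite /ti /adjacent_tperm tpermJ !tpermD //; apply: ord_neq => /=; lia.
rewrite !big_cons big_nil /= !mulg1 !mulgA !tpermJE !tpermJ.
have -> : ord_left j = ord_right i by apply: val_inj.
rewrite tpermL tpermR !tpermD // ; apply: ord_neq => /=; lia.
Qed.

Definition braid_perm : braid_group -> 'S_n := presented_lift adjacent_tperm_rel.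
HB.instance Definition _ := Multiplicative.on braid_perm.

Definition pure_braid : normal_subgroup braid_group := morph_kernel braid_perm.
End Braid.

Section Smooth.
Variables (R : realType) (d : nat).
Implicit Types (O : set 'rV[R]_d) (f : 'rV[R]_d -> R).

Definition basis_vector (i : 'I_d) : 'rV[R]_d := delta_mx ord0 i.

Definition partial (i : 'I_d) f : 'rV[R]_d -> R :=
  fun y => 'D_(basis_vector i) f y.

Definition partials (s : seq 'I_d) f : 'rV[R]_d -> R := foldr partial f s.

(* Meaningful for O open: all iterated partial derivatives of f exist and are
   continuous at the points of O. *)
Definition smooth_on O f := forall (s : seq 'I_d) y, O y ->
  {for y, continuous (partials s f)} /\
  forall i, derivable (partials s f) y (basis_vector i).
End Smooth.

(* A closed (compact, connected, without boundary) Riemannian manifold, given by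
   a smooth atlas and, in each chart, the Gram matrix of the metric in the
   coordinate frame. Second countability follows from compactness. *)
Record closed_riemannian (R : realType) (d : nat) := ClosedRiemannian {
  carrier :> topologicalType;
  carrier_hausdorff : hausdorff_space carrier;
  carrier_compact : compact [set: carrier];
  carrier_connected : connected [set: carrier];
  chart_index : Type;
  chart_dom : chart_index -> set carrier;
  chart : chart_index -> carrier -> 'rV[R]_d;
  chart_inv : chart_index -> 'rV[R]_d -> carrier;
  chart_cover : forall x, exists a, chart_dom a x;
  chart_dom_open : forall a, open (chart_dom a);
  chart_cod_open : forall a, open (chart a @` chart_dom a);
  chartK : forall a x, chart_dom a x -> chart_inv a (chart a x) = x;
  chart_continuous : forall a, {within chart_dom a, continuous (chart a)};
  chart_inv_continuous : forall a,
    {within chart a @` chart_dom a, continuous (chart_inv a)};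
  transition_smooth : forall a b (j : 'I_d),
    smooth_on (chart a @` (chart_dom a `&` chart_dom b))
      (fun y => chart b (chart_inv a y) ord0 j);
  metric : chart_index -> 'rV[R]_d -> 'M[R]_d;
  metric_smooth : forall a i j,
    smooth_on (chart a @` chart_dom a) (fun y => metric a y i j);
  metric_symmetric : forall a y, (chart a @` chart_dom a) y ->
    (metric a y)^T = metric a y;
  metric_posdef : forall a y, (chart a @` chart_dom a) y ->
    forall v : 'rV[R]_d, v != 0 -> 0 < (v *m metric a y *m v^T) ord0 ord0;
  metric_compatible : forall a b y,
    (chart a @` (chart_dom a `&` chart_dom b)) y ->
    let J := \matrix_(i, j)
      partial i (fun z => chart b (chart_inv a z) ord0 j) y in
    metric a y = J *m metric b (chart b (chart_inv a y)) *m J^T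
}.

Section Curvature.
Variables (R : realType) (d : nat) (g : 'rV[R]_d -> 'M[R]_d).

Definition christoffel (k i j : 'I_d) : 'rV[R]_d -> R := fun y =>
  2^-1 * \sum_l invmx (g y) k l *
    (partial i (fun z => g z j l) y + partial j (fun z => g z i l) y
     - partial l (fun z => g z i j) y).

(* dx^l (R(e_i, e_j) e_k), for e_i the coordinate vector fields; all these
   components vanish at a point iff the sectional curvatures do. *)
Definition riemann_tensor (l k i j : 'I_d) : 'rV[R]_d -> R := fun y =>
  partial i (christoffel l j k) y - partial j (christoffel l i k) y
  + \sum_m (christoffel l i m y * christoffel m j k y
            - christoffel l j m y * christoffel m i k y).
End Curvature.

Definition flat (R : realType) (d : nat) (M : closed_riemannian R d) :=
  forall (a : chart_index M) y, (chart a @` chart_dom a) y ->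
  forall l k i j, riemann_tensor (metric a) l k i j y = 0.

Section FundamentalGroup.
Variables (R : realType) (T : topologicalType) (x : T).
Implicit Types p q : R -> T.

(* Only the values on [0, 1] matter. *)
Definition is_loop p :=
  [/\ {within `[0, 1]%classic, continuous p}, p 0 = x & p 1 = x].

Definition loop_cat p q : R -> T := fun t =>
  if t <= 2^-1 then p (2 * t) else q (2 * t - 1).

Definition loop_homotopic p q := exists h : R * R -> T,
  [/\ {within `[0, 1]%classic `*` `[0, 1]%classic, continuous h},
      forall t, t \in `[0, 1] -> h (0, t) = p t /\ h (1, t) = q t &
      forall s, s \in `[0, 1] -> h (s, 0) = x /\ h (s, 1) = x].

(* Pi is isomorphic to the group of homotopy classes of loops at x. *)
Definition is_pi1 (Pi : groupType) := exists cls : (R -> T) -> Pi,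
  [/\ forall p q, is_loop p -> is_loop q ->
        cls (loop_cat p q) = (cls p * cls q)%g,
      forall p q, is_loop p -> is_loop q ->
        (cls p = cls q <-> loop_homotopic p q) &
      forall u, exists2 p, is_loop p & cls p = u].
End FundamentalGroup.

(* Pi is a Bieberbach group of dimension d with point group Phi:
   0 -> Z^d --i--> Pi --p--> Phi -> 1 is exact, Phi acts faithfully on Z^d by
   conjugation, and Pi is torsion-free. *)
Definition bieberbach (d : nat) (Pi : groupType) (Phi : finGroupType) :=
  exists (i : 'rV[int]_d -> Pi) (p : {multiplicative Pi -> Phi}),
  [/\ injective i /\ {morph i : u v / u + v >-> (u * v)%g},
      forall phi, exists u, p u = phi,
      forall u, p u = 1%g <-> exists v, i v = u,
      forall u, (forall v, (i v ^ u)%g = i v) -> p u = 1%g &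
      forall (u : Pi) k, (0 < k)%N -> (u ^+ k)%g = 1%g -> u = 1%g].

(* The holonomy group of a flat manifold is the point group of its fundamental
   group, which is determined up to isomorphism. *)
Definition holonomy_group (R : realType) (d : nat) (M : closed_riemannian R d)
    (H : finGroupType) :=
  exists (x : M) (Pi : groupType), is_pi1 R x Pi /\ bieberbach d Pi H.

Definition pi1_embeds (R : realType) (d : nat) (M : closed_riemannian R d)
    (G : groupType) :=
  exists (x : M) (Pi : groupType), is_pi1 R x Pi /\
  exists f : {multiplicative Pi -> G}, injective f.

(* Main.v *)
(* B_n/[P_n,P_n] maps to the group of affine maps x |-> (x_(s j))_j + v of
   R^(n(n-1)/2), the coordinates being indexed by the pairs {i, j}: sigma_i is sent
   to the transposition (i, i+1) acting on pairs, followed by the translation by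
   the basis vector of the pair {i, i+1}. This map is injective: the classes
   A_(i,j) of the standard generators of P_n are permuted under conjugation by the
   sigma_k, hence by the Coxeter presentation of S_n they generate P_n/[P_n,P_n],
   and A_(i,j) acts as the translation by twice a basis vector. Modulo 2, the
   translation part of x records which pairs are inverted by the permutation of x;
   in particular an involution swapping i and j has an odd {i, j} coordinate, and
   its square is a nonzero translation. So the preimage Pi of a 2-subgroup H of
   S_n is torsion free, an extension of H by the lattice 2 Z^(n(n-1)/2).

   Pi acts on R^(n(n-1)/2) by isometries of the sup norm. The |H|-th power of any
   element is a lattice translation, so a nontrivial element displaces every point
   by at least 1/|H|. This uniform bound makes R^(n(n-1)/2) -> R^(n(n-1)/2)/Pi a
   covering with single-valued affine transition maps, and makes the endpoint of a
   lifted loop locally constant along homotopies. *)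
Require Import Defs.
From mathcomp Require Import all_boot all_order all_algebra all_fingroup all_solvable.
From mathcomp Require Import all_classical all_reals all_analysis.
From HB Require Import structures.
From mathcomp Require Import generic_quotient zify lra.

Set Implicit Arguments.
Unset Strict Implicit.
Unset Printing Implicit Defensive.

(** * The Coxeter presentation of the symmetric group *)

Section CoxeterWords.
Local Open Scope group_scope.

(** Letters are natural numbers, and the families used below take the value 1 beyond the last
    generator. This respects the first two relations but not the braid relation, which is therefore
    required only below [m]. *)
Definition coxeter_family (K : groupType) (s : nat -> K) (m : nat) :=
  [/\ forall i, s i * s i = 1,
      forall i j, (i.+1 < j)%N -> s i * s j = s j * s i &
      forall i, (i.+1 < m)%N -> s i.+1 * s i * s i.+1 = s i * s i.+1 * s i].

Definition word_prod (K : groupType) (s : nat -> K) (u : seq nat) : K :=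
  \prod_(i <- u) s i.

Lemma word_prod_cat (K : groupType) (s : nat -> K) u v :
  word_prod s (u ++ v) = word_prod s u * word_prod s v.
Proof. by rewrite /word_prod big_cat. Qed.

Lemma word_prod1 (K : groupType) (s : nat -> K) i : word_prod s [:: i] = s i.
Proof. by rewrite /word_prod big_seq1. Qed.

Lemma word_prod_comm (K : groupType) (s : nat -> K) j u :
  (forall i, i \in u -> s i * s j = s j * s i) ->
  word_prod s u * s j = s j * word_prod s u.
Proof.
elim: u => [_|i u IHu iu]; first by rewrite /word_prod big_nil mul1g mulg1.
rewrite -cat1s word_prod_cat word_prod1 -mulgA IHu; last first.
  by move=> k ku; apply: iu; rewrite inE ku orbT.
by rewrite !mulgA iu ?mem_head.
Qed.

(** The word m-1, ..., k. Products in the symmetric group apply the left factor first, so this run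
    carries the point [m] down to [k]. *)
Definition descent m k := rev (iota k (m - k)).

Lemma mem_descent m k i : i \in descent m k = (k <= i < m)%N.
Proof. rewrite mem_rev mem_iota; lia. Qed.

Lemma descent_cat m j k : (k <= j <= m)%N ->
  descent m k = descent m j ++ descent j k.
Proof.
move=> kjm; rewrite /descent -rev_cat; congr rev.
by rewrite (_ : m - k = (j - k) + (m - j))%N ?iotaD ?subnKC //; lia.
Qed.

Lemma descent1 k : descent k.+1 k = [:: k].
Proof. by rewrite /descent subSnn. Qed.

Lemma descentmm k : descent k k = [::].
Proof. by rewrite /descent subnn. Qed.

(* The descending runs are coset representatives of the subgroup generated by the
   letters < m: right multiplication by a letter permutes these cosets. *)
Lemma coxeter_normal_form (m : nat) (u : seq nat) : all (ltn^~ m.+1) u ->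
  exists u' k, [/\ all (ltn^~ m) u', (k <= m.+1)%N &
    forall (K : groupType) (s : nat -> K), coxeter_family s m.+1 ->
      word_prod s u = word_prod s (u' ++ descent m.+1 k)].
Proof.
elim/last_ind: u => [_|u j IHu]; first by exists [::], m.+1; rewrite descentmm.
rewrite all_rcons => /andP[/= jm /IHu[u' [k [u'm km uE]]]].
(* The new letter [j] meets the run that ends at [k]. For k < j it crosses the run by the braid
   relation and comes out as j-1; for j < k it extends the run if j+1 = k and commutes with it
   otherwise; for j = k it cancels the last letter. *)
have [kj|jk|jk] := ltngtP k j.
- case: j jm kj => // j jm kj.
  exists (rcons u' j), k; split; rewrite ?all_rcons ?u'm ?andbT //.
  move=> K s cs; have [s2 sfar snear] := cs;
    rewrite -cats1 word_prod_cat uE // word_prod1.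
  rewrite -cats1 -catA !word_prod_cat -mulgA; congr (_ * _).
  rewrite (@descent_cat m.+1 j.+2 k); last lia.
  rewrite (@descent_cat j.+2 j.+1 k); last lia.
  rewrite (@descent_cat j.+1 j k) ?leqnSn ?andbT // !descent1 !word_prod_cat !word_prod1.
  have far : word_prod s (descent j k) * s j.+1 = s j.+1 * word_prod s (descent j k).
    by apply: word_prod_comm => i; rewrite mem_descent => /andP[_ ij];
      exact: sfar.
  have far' : word_prod s (descent m.+1 j.+2) * s j = s j * word_prod s (descent m.+1 j.+2).
    by apply: word_prod_comm => i; rewrite mem_descent => /andP[ji _];
      exact/esym/sfar.
  rewrite -!mulgA far !mulgA -far'; congr (_ * _).
  by rewrite -!mulgA; congr (_ * _); rewrite !mulgA snear.
- have [jk1|jk1] := eqVneq j.+1 k.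
    exists u', j; split=> //; first lia.
    move=> K s cs; rewrite -cats1 word_prod_cat uE // -word_prod_cat -catA.
    by rewrite (@descent_cat _ k j) -?jk1 ?descent1 //; lia.
  exists (rcons u' j), k; split=> //; first by rewrite all_rcons u'm andbT /=;
    lia.
  move=> K s cs; have [s2 sfar snear] := cs;
    rewrite -cats1 word_prod_cat uE // word_prod1.
  rewrite -cats1 -catA !word_prod_cat -mulgA word_prod1 word_prod_comm // => i.
  by rewrite mem_descent => ?; apply/esym/sfar; lia.
- exists u', k.+1; split=> //; first by rewrite jk; exact: jm.
  move=> K s cs; have [s2 sfar snear] := cs;
    rewrite -cats1 word_prod_cat uE // word_prod1.
  rewrite !word_prod_cat (@descent_cat _ k.+1 k) ?descent1;
    last by rewrite jk ltnW //=; exact: jm.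
  by rewrite word_prod_cat word_prod1 -!mulgA -jk s2 mulg1.
Qed.

Lemma coxeter_family_le (K : groupType) (s : nat -> K) m m' :
  (m' <= m)%N -> coxeter_family s m -> coxeter_family s m'.
Proof. by move=> mm' [s2 sfar snear]; split=> // i im; apply: snear; lia. Qed.

Variable n : nat.

Definition sym_gen (i : nat) : 'S_n :=
  if insub i is Some j then @adjacent_tperm n j else 1.

Lemma sym_genE i (x : 'I_n) : sym_gen i x =
  (if (i.+1 < n)%N then
    if x == i :> nat then i.+1 else if x == i.+1 :> nat then i else x
  else x) :> nat.
Proof.
rewrite /sym_gen; case: insubP => [j jn ij|jn]; last first.
  by rewrite perm1 ifF //; lia.
rewrite ifT; last by move: (jn); lia.
have {}ij : nat_of_ord j = i by [].
rewrite /adjacent_tperm; case: tpermP => [->|->|xl xr] /=.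
- by rewrite ij eqxx.
- by rewrite ij eqxx ifF //; lia.
- rewrite !ifF //; apply/eqP.
    by move=> xi; apply: xr; apply/val_inj; rewrite /= ij.
  by move=> xi; apply: xl; apply/val_inj; rewrite /= ij.
Qed.

Lemma sym_gen_coxeter : coxeter_family sym_gen n.-1.
Proof.
split=> [i|i j ij|i im]; apply/permP => x; apply/val_inj;
  rewrite /= ?perm1 ?permM !sym_genE; (repeat case: ifP); lia.
Qed.

Lemma word_prod_sym_fix (m : nat) u (x : 'I_n) : all (ltn^~ m) u -> (m < x)%N ->
  word_prod sym_gen u x = x.
Proof.
move=> um mx; elim: u um => [_|j u IHu /= /andP[jm /IHu ux]].
  by rewrite /word_prod big_nil perm1.
rewrite -cat1s word_prod_cat word_prod1 permM.
suff -> : sym_gen j x = x by [].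
by apply/val_inj; rewrite /= sym_genE; (repeat case: ifP); lia.
Qed.

Lemma descent_sym m k (x : 'I_n) : (k <= m)%N -> m = x :> nat ->
  word_prod sym_gen (descent m k) x = k :> nat.
Proof.
elim: m x => [|m IHm] x km mx.
  have -> : k = 0%N by lia.
  by rewrite descentmm /word_prod big_nil perm1.
have [->|km1] := eqVneq k m.+1;
  first by rewrite descentmm /word_prod big_nil perm1.
rewrite (@descent_cat _ m) ?descent1 ?word_prod_cat ?word_prod1 ?permM;
  last lia.
have sx : sym_gen m x = m :> nat.
  by rewrite sym_genE; have := ltn_ord x; (repeat case: ifP); lia.
by apply: IHm; lia.
Qed.

(** Evaluate the normal form at the largest point that the letters can move: the shorter word fixes
    it and the run sends it to [k]. For the identity permutation the run is thus empty, and
    induction on the bound of the letters applies, the family [s] being kept. *)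
Lemma coxeter_presentation (K : groupType) (s : nat -> K) u :
  coxeter_family s n.-1 -> all (ltn^~ n.-1) u ->
  word_prod sym_gen u = 1 -> word_prod s u = 1.
Proof.
move=> cs; have : (n.-1 <= n.-1)%N by [].
move: {1 3}n.-1 => m; elim: m u => [|m IHm] u mn; first by case: u => // _;
  rewrite /word_prod !big_nil.
move=> /coxeter_normal_form[u' [k [u'm km uE]]] u1.
have mn' : (m.+1 < n)%N by lia.
have kE : k = m.+1.
  have := congr1 (fun w : 'S_n => val (w (Ordinal mn'))) u1.
  rewrite uE; last exact: coxeter_family_le sym_gen_coxeter.
  rewrite word_prod_cat permM (word_prod_sym_fix u'm) // perm1 /=.
  by rewrite descent_sym.
have uE' (K' : groupType) (s' : nat -> K') : coxeter_family s' n.-1 ->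
    word_prod s' u = word_prod s' u'.
  move=> cs'; rewrite uE; last exact: coxeter_family_le cs'.
  by rewrite kE descentmm cats0.
rewrite uE' //; apply: IHm => //; first exact: ltnW.
by rewrite -uE' //; exact: sym_gen_coxeter.
Qed.

End CoxeterWords.

(** * Quotient groups and integral affine groups *)

Section MultiplicativeGroups.
Local Open Scope group_scope.
Variables (G K : groupType) (f : {multiplicative G -> K}).

Lemma gmult1 : f 1 = 1.
Proof. by apply: (mulgI (f 1)); rewrite -gmulfM !mulg1. Qed.

Lemma gmultV x : f x^-1 = (f x)^-1.
Proof. by apply: (mulgI (f x)); rewrite -gmulfM !mulgV gmult1. Qed.

Lemma gmultX x k : f (x ^+ k) = f x ^+ k.
Proof. by elim: k => [|k IHk]; rewrite ?expg0 ?gmult1 // !expgS gmulfM IHk. Qed.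

Lemma gmultJ x y : f (x ^ y) = f x ^ f y.
Proof. by rewrite /conjg !gmulfM gmultV. Qed.

Lemma gmult_inj : (forall x, f x = 1 -> x = 1) -> injective f.
Proof.
move=> f1 x y fxy; apply: (mulgI y^-1); rewrite mulVg; apply: f1.
by rewrite gmulfM gmultV fxy mulVg.
Qed.

End MultiplicativeGroups.

Section QuotientLift.
Local Open Scope group_scope.
Variables (G K : groupType) (N : normal_subgroup G).

Lemma coset_classM : {morph @coset_class G N : x y / x * y}.
Proof. by move=> x y; rewrite -quotient_mulE. Qed.

HB.instance Definition _ :=
  isMultiplicative.Build G (group_quotient N) (@coset_class G N) coset_classM.

Definition quotient_lift (f : {multiplicative G -> K})
  of (forall x, N x -> f x = 1) := fun x : group_quotient N => f (repr x).

Variables (f : {multiplicative G -> K}) (fN : forall x, N x -> f x = 1).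

Lemma quotient_liftE x : quotient_lift fN (coset_class N x) = f x.
Proof.
have /coset_classP/fN : coset_class N (repr (coset_class N x)) = coset_class N x.
  by rewrite coset_class_repr.
by rewrite gmulfM gmultV => /(congr1 (mul (f (repr (coset_class N x)))));
  rewrite mulKVg mulg1.
Qed.

Fact quotient_lift_morph : {morph quotient_lift fN : x y / x * y}.
Proof.
move=> x y; rewrite -[x]coset_class_repr -[y]coset_class_repr.
by rewrite -coset_classM !quotient_liftE gmulfM.
Qed.

HB.instance Definition _ :=
  isMultiplicative.Build (group_quotient N) K (quotient_lift fN) quotient_lift_morph.

End QuotientLift.

Section CommutatorKernel.
Local Open Scope group_scope.

Lemma commutator_set_morph (G K : groupType) (f : {multiplicative G -> K}) (P : normal_subgroup G) :
  (forall x y, P x -> P y -> f x * f y = f y * f x) ->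
  forall z, commutator_set P z -> f z = 1.
Proof.
move=> fP z; elim=> [|_ [x [y [Px Py ->]]]|x y _ fx _ fy|x _ fx].
- exact: gmult1.
- by rewrite /commg /conjg !gmulfM !gmultV fP // mulKg mulVg.
- by rewrite gmulfM fx fy mulg1.
- by rewrite gmultV fx invg1.
Qed.

Lemma quotient_commute (G : groupType) (P : normal_subgroup G) x y : P x -> P y ->
  let c := coset_class (commutator_subgroup P) in c x * c y = c y * c x.
Proof.
move=> Px Py c; rewrite -!coset_classM; apply/coset_classP.
by apply: generated_incl; exists y, x; split=> //;
  rewrite invgM /commg /conjg !mulgA.
Qed.

End CommutatorKernel.

Section LatticePerm.
Local Open Scope group_scope.
Variable d : nat.

(* (v, s) stands for the affine map x |-> (x_(s j))_j + v. *)
Definition lattice_perm := ('rV[int]_d * 'S_d)%type.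
HB.instance Definition _ := Choice.on lattice_perm.
Implicit Types x y z : lattice_perm.

Definition lp_one : lattice_perm := (0%R, 1).
Definition lp_mul x y : lattice_perm := ((x.1 + col_perm x.2 y.1)%R, x.2 * y.2).
Definition lp_inv x : lattice_perm := ((- col_perm (x.2)^-1 x.1)%R, (x.2)^-1).

Fact lp_mulA : associative lp_mul.
Proof.
move=> x y z; congr (_, _) => /=; last exact: mulgA.
by apply/rowP => j; rewrite !mxE permM GRing.addrA.
Qed.

Fact lp_mul1 : left_id lp_one lp_mul.
Proof.
move=> [v s]; congr (_, _) => /=; last exact: mul1g.
by apply/rowP => j; rewrite !mxE perm1 GRing.add0r.
Qed.

Fact lp_1mul : right_id lp_one lp_mul.
Proof.
move=> [v s]; congr (_, _) => /=; last exact: mulg1.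
by apply/rowP => j; rewrite !mxE GRing.addr0.
Qed.

Fact lp_mulV : left_inverse lp_one lp_inv lp_mul.
Proof.
move=> x; congr (_, _) => /=; last exact: mulVg.
by apply/rowP => j; rewrite !mxE GRing.addNr.
Qed.

Fact lp_Vmul : right_inverse lp_one lp_inv lp_mul.
Proof.
move=> x; congr (_, _) => /=; last exact: mulgV.
by apply/rowP => j; rewrite !mxE permK GRing.addrN.
Qed.

HB.instance Definition _ := isGroup.Build lattice_perm lp_mulA lp_mul1 lp_1mul lp_mulV lp_Vmul.

Lemma lp_mulE x y : x * y = ((x.1 + col_perm x.2 y.1)%R, x.2 * y.2).
Proof. by []. Qed.

Lemma lp_invE x : x^-1 = ((- col_perm (x.2)^-1 x.1)%R, (x.2)^-1).
Proof. by []. Qed.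

Lemma lp_translate_conj (v : 'rV[int]_d) x :
  (((v, 1) : lattice_perm) ^ x) = (col_perm (x.2)^-1 v, 1) :> lattice_perm.
Proof.
rewrite /conjg !lp_mulE lp_invE; congr (_, _) => /=;
  last by rewrite mul1g mulVg.
by apply/rowP => j; rewrite !mxE perm1 [LHS]GRing.addrC GRing.addrK.
Qed.

Lemma lp_translateM (u v : 'rV[int]_d) :
  ((u, 1) : lattice_perm) * (v, 1) = ((u + v)%R, 1) :> lattice_perm.
Proof.
rewrite lp_mulE; congr (_, _) => /=; last exact: mul1g.
by apply/rowP => j; rewrite !mxE perm1.
Qed.

Lemma lp_translateV (u : 'rV[int]_d) :
  ((u, 1) : lattice_perm)^-1 = ((- u)%R, 1) :> lattice_perm.
Proof.
rewrite lp_invE; congr (_, _) => /=; last exact: invg1.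
by apply/rowP => j; rewrite !mxE invg1 perm1.
Qed.

Lemma lp_translateX (u : 'rV[int]_d) k :
  ((u, 1) : lattice_perm) ^+ k = ((u *+ k)%R, 1) :> lattice_perm.
Proof.
elim: k => [|k IHk]; first by rewrite expg0 GRing.mulr0n.
by rewrite expgS IHk lp_translateM GRing.mulrS.
Qed.

Lemma lp_perm_morph x y : (x * y).2 = x.2 * y.2.
Proof. by []. Qed.

(** [col_perm s] puts coordinate [s j] at position [j], so basis vectors move by the inverse
    permutation. *)
Lemma col_perm_delta (s : 'S_d) (e : 'I_d) :
  col_perm s (delta_mx ord0 e) = delta_mx ord0 (s^-1 e) :> 'rV[int]_d.
Proof.
by apply/rowP => j; rewrite !mxE /= -{2}(permK s j) (inj_eq perm_inj).
Qed.

End LatticePerm.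

(** * Unordered pairs of strands and the action of permutations on them *)

Section Pairs.
Local Open Scope group_scope.
Variable n : nat.

Definition pair_dim := (n * (n - 1) %/ 2)%N.

Definition pair_type := {P : {set 'I_n} | #|P| == 2}.

Lemma card_pair_type : #|{: pair_type}| = pair_dim.
Proof.
rewrite card_sig (eq_card (B := [set P : {set 'I_n} | #|P| == 2])).
  by rewrite card_draws card_ord bin2 /pair_dim divn2 subn1.
by move=> P; rewrite !inE.
Qed.

Definition pair_set (e : 'I_pair_dim) : {set 'I_n} :=
  val (enum_val (cast_ord (esym card_pair_type) e)).

Lemma card_pair_set e : #|pair_set e| = 2.
Proof. exact/eqP/(valP (enum_val (cast_ord (esym card_pair_type) e))). Qed.

Lemma pair_set_inj : injective pair_set.
Proof. by move=> e f /val_inj/enum_val_inj/cast_ord_inj. Qed.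

Lemma pair_set_surj (P : {set 'I_n}) : #|P| = 2 -> exists e, pair_set e = P.
Proof.
move=> /eqP P2; exists (cast_ord card_pair_type (enum_rank (Sub P P2 : pair_type))).
by rewrite /pair_set cast_ordK enum_rankK SubK.
Qed.

Lemma pair_setP e : exists i j : 'I_n, (i < j)%N /\ pair_set e = [set i; j].
Proof.
have /cards2P[i [j [ij ->]]] := introT eqP (card_pair_set e).
have [ltij|ltji|/val_inj E] := ltngtP i j; last by rewrite E eqxx in ij.
  by exists i, j.
by exists j, i; rewrite finset.setUC.
Qed.

(** The default [e] is never returned, since a permutation sends a pair to a pair. *)
Definition pair_image (w : 'S_n) e : 'I_pair_dim :=
  odflt e [pick e' | pair_set e' == w @: pair_set e].

Lemma pair_imageE w e : pair_set (pair_image w e) = w @: pair_set e.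
Proof.
rewrite /pair_image; case: pickP => [e' /eqP //|no].
have [|e' e'E] := @pair_set_surj (w @: pair_set e); last first.
  by have := no e'; rewrite e'E eqxx.
by rewrite card_imset ?card_pair_set //; exact: perm_inj.
Qed.

Lemma pair_image_inj w : injective (pair_image w).
Proof.
move=> e f /(congr1 pair_set); rewrite !pair_imageE.
by move=> /(imset_inj (@perm_inj _ w))/pair_set_inj.
Qed.

Definition pair_perm (w : 'S_n) : 'S_pair_dim := perm (@pair_image_inj w).

Lemma pair_permE w e : pair_set (pair_perm w e) = w @: pair_set e.
Proof. by rewrite permE pair_imageE. Qed.

Lemma pair_permM : {morph pair_perm : v w / v * w}.
Proof.
move=> v w; apply/permP => e; apply: pair_set_inj.
rewrite permM !pair_permE -imset_comp; apply: eq_imset => i; exact: permM.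
Qed.

HB.instance Definition _ := isMultiplicative.Build 'S_n 'S_pair_dim pair_perm pair_permM.

(* The value of [edge i i]. *)
Variable e0 : 'I_pair_dim.

Definition edge (i j : 'I_n) : 'I_pair_dim := odflt e0 [pick e | pair_set e == [set i; j]].

Lemma edgeP i j : i != j -> pair_set (edge i j) = [set i; j].
Proof.
move=> ij; rewrite /edge; case: pickP => [e /eqP //|no].
have [|e eE] := @pair_set_surj [set i; j]; first by rewrite cards2 ij.
by have := no e; rewrite eE eqxx.
Qed.

Lemma edgeC i j : edge i j = edge j i.
Proof. by rewrite /edge finset.setUC. Qed.

Lemma edge_surj e : exists i j : 'I_n, (i < j)%N /\ e = edge i j.
Proof.
have [i [j [ij eE]]] := pair_setP e; exists i, j; split=> //.
by apply: pair_set_inj; rewrite edgeP // neq_ltn ij.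
Qed.

Lemma pair_perm_edge w i j : i != j -> pair_perm w (edge i j) = edge (w i) (w j).
Proof.
move=> ij; apply: pair_set_inj.
by rewrite pair_permE !edgeP ?(inj_eq perm_inj) // imsetU1 imset_set1.
Qed.

End Pairs.

(** * The affine action of the braid group *)

Section BraidAffine.
Local Open Scope group_scope.
Variables (n : nat) (e0 : 'I_(pair_dim n)).
Local Notation d := (pair_dim n).
Local Notation edge := (edge e0).

Definition braid_gen (i : 'I_n.-1) : braid_group n := word_class (@braid_rel n) [:: (i, true)].

Lemma braid_ind (P : braid_group n -> Prop) : P 1 ->
  (forall x y, P x -> P y -> P (x * y)) -> (forall x, P x -> P x^-1) ->
  (forall i, P (braid_gen i)) -> forall x, P x.
Proof.
move=> P1 PM PV Pg x; rewrite -[x]word_class_repr.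
elim: (repr x) => [//|[i b] u IHu].
rewrite -cat1s -presented_mulE; apply: PM => //; case: b; first exact: Pg.
rewrite (_ : word_class _ _ = (braid_gen i)^-1); first exact/PV/Pg.
apply: (mulgI (braid_gen i)); rewrite mulgV.
rewrite [LHS]presented_mulE; apply/word_classP.
exact: (word_eq_cancel _ i true).
Qed.

Lemma braid_perm_gen i : braid_perm (braid_gen i) = adjacent_tperm i.
Proof.
rewrite /braid_perm /presented_lift (word_eval_eq (@adjacent_tperm_rel n) (word_repr _ _)).
by rewrite /word_eval big_seq1.
Qed.

Definition artin_affine (i : 'I_n.-1) : lattice_perm d :=
  (delta_mx ord0 (edge (ord_left i) (ord_right i)), pair_perm (adjacent_tperm i)).

Lemma adjacent_edge (i : 'I_n.-1) (k l : 'I_n) : k != l ->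
  col_perm (pair_perm (adjacent_tperm i)) (delta_mx ord0 (edge k l)) =
  delta_mx ord0 (edge (adjacent_tperm i k) (adjacent_tperm i l)) :> 'rV[int]_d.
Proof.
move=> kl; rewrite col_perm_delta -gmultV.
have -> : (adjacent_tperm i)^-1 = adjacent_tperm i by rewrite /adjacent_tperm tpermV.
by rewrite pair_perm_edge.
Qed.

(** The permutation parts agree because the transpositions satisfy the relations. In the braid
    relation both translation parts are the sum of the basis vectors of the three edges on i, i+1,
    i+2, met in opposite orders. *)
Fact artin_affine_rel u v : @braid_rel n u v ->
  word_eval artin_affine u = word_eval artin_affine v.
Proof.
move=> uv.
have ev w : (word_eval artin_affine w).2 = pair_perm (word_eval (@adjacent_tperm n) w).
  rewrite /word_eval; elim: w => [|[i b] w IHw];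
    first by rewrite !big_nil gmult1.
  by rewrite !big_cons lp_perm_morph IHw gmulfM; case: b => //=; rewrite gmultV.
have E2 : (word_eval artin_affine u).2 = (word_eval artin_affine v).2.
  by rewrite !ev (adjacent_tperm_rel uv).
suff E1 : (word_eval artin_affine u).1 = (word_eval artin_affine v).1.
  by rewrite [LHS]surjective_pairing E1 E2 -surjective_pairing.
have lr (i : 'I_n.-1) : ord_left i != ord_right i.
  by apply/eqP => /(congr1 val) /=; lia.
have neq (i j : 'I_n) : i != j :> nat -> i != j by [].
case: uv {ev E2} => [i j ij|i j ij];
  rewrite /word_eval !big_cons big_nil !mulg1 !lp_mulE /=.
  rewrite !adjacent_edge // !tpermD 1?GRing.addrC //; apply: neq => /=; lia.
have E : ord_left j = ord_right i by apply: val_inj.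
have il : ord_left i != ord_right j by apply: neq => /=; lia.
rewrite !GRing.raddfD /= !adjacent_edge ?inj_eq //; last 2 first.
- exact: perm_inj.
- exact: perm_inj.
have t1 : adjacent_tperm j (ord_left i) = ord_left i.
  by rewrite /adjacent_tperm tpermD //; apply: neq => /=; lia.
have t2 : adjacent_tperm j (ord_right i) = ord_right j.
  by rewrite -E /adjacent_tperm tpermL.
have t3 : adjacent_tperm j (ord_right j) = ord_right i.
  by rewrite -E /adjacent_tperm tpermR.
have s1 : adjacent_tperm i (ord_left i) = ord_right i by rewrite /adjacent_tperm tpermL.
have s2 : adjacent_tperm i (ord_right i) = ord_left i by rewrite /adjacent_tperm tpermR.
have s3 : adjacent_tperm i (ord_right j) = ord_right j.
  by rewrite /adjacent_tperm tpermD //; apply: neq => /=; lia.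
rewrite E ?(t1, t2, t3, s1, s2, s3) ?(t1, t2, t3, s1, s2, s3) GRing.addrC -GRing.addrA.
rewrite [RHS]GRing.addrC -[RHS]GRing.addrA.
by congr (_ + _)%R; exact: GRing.addrC.
Qed.

Definition braid_affine : braid_group n -> lattice_perm d :=
  presented_lift artin_affine_rel.
HB.instance Definition _ := Multiplicative.on braid_affine.

Lemma braid_affine_gen i : braid_affine (braid_gen i) = artin_affine i.
Proof.
rewrite /braid_affine /presented_lift (word_eval_eq artin_affine_rel (word_repr _ _)).
by rewrite /word_eval big_seq1.
Qed.

Lemma braid_affine_perm x : (braid_affine x).2 = pair_perm (braid_perm x).
Proof.
elim/braid_ind: x => [|x y xE yE|x xE|i].
- by rewrite !gmult1.
- by rewrite !gmulfM lp_perm_morph xE yE.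
- by rewrite !gmultV lp_invE /= xE.
- by rewrite braid_affine_gen braid_perm_gen.
Qed.

Lemma edge_eq (i j k l : 'I_n) : i != j -> k != l ->
  (edge i j == edge k l) = (i == k) && (j == l) || (i == l) && (j == k).
Proof.
move=> ij kl; apply/eqP/orP => [|[] /andP[/eqP-> /eqP->] //]; last exact: edgeC.
move=> /(congr1 (@pair_set n)); rewrite !edgeP // => E.
have : i \in [set k; l] by rewrite -E !inE eqxx.
have : j \in [set k; l] by rewrite -E !inE eqxx orbT.
rewrite !inE => /orP[]/eqP jE /orP[]/eqP iE; move: ij; rewrite iE jE !eqxx //.
  by right.
by left.
Qed.

Lemma adjacent_tpermE (i : 'I_n.-1) (x : 'I_n) : adjacent_tperm i x =
  (if x == i :> nat then i.+1 else if x == i.+1 :> nat then nat_of_ord i else x) :> nat.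
Proof.
have := sym_genE i x; rewrite /sym_gen valK => ->.
by rewrite ifT //; have := ltn_ord i; lia.
Qed.

(** Both sides are cocycles modulo 2: whether a product inverts {i, j} is the sum of the
    contributions of [x] at {i, j} and of [y] at its image under [x], exactly as translation parts
    add up. They agree on a generator, which inverts only the pair {k, k+1}. *)
Lemma braid_affine_parity x (i j : 'I_n) : i != j ->
  (((braid_affine x).1 ord0 (edge i j))%:~R =
   ((i < j)%N (+) (braid_perm x i < braid_perm x j)%N)%:R :> 'F_2)%R.
Proof.
elim/braid_ind: x i j => [|x y xE yE|x xE|k] i j ij.
- by rewrite !gmult1 !perm1 addbb mxE.
- rewrite !gmulfM lp_mulE /= !mxE braid_affine_perm pair_perm_edge //.
  rewrite GRing.rmorphD /= xE // yE ?inj_eq //; last exact: perm_inj.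
  by rewrite !permM; do 3 case: (_ < _)%N; apply/eqP.
- rewrite !gmultV lp_invE /= !mxE braid_affine_perm -gmultV pair_perm_edge //.
  rewrite GRing.rmorphN /= xE ?inj_eq ?permKV //; last exact: perm_inj.
  by do 2 case: (_ < _)%N; apply/eqP.
- rewrite braid_affine_gen braid_perm_gen /= mxE eqxx /= edge_eq //; last first.
    by apply/eqP => /(congr1 val) /=; lia.
  rewrite !adjacent_tpermE; set b := (_ || _); set c := (_ (+) _).
  suff -> : b = c by case: c.
  have {ij} ij : i != j :> nat by [].
  have ordE (k' l' : 'I_n) : (k' == l') = (k' == l' :> nat) by [].
  by rewrite /b /c !ordE /=; (repeat case: ifP); lia.
Qed.

Local Notation Q := (group_quotient (commutator_subgroup (pure_braid n))).

Fact braid_perm_commutator x : commutator_subgroup (pure_braid n) x -> braid_perm x = 1.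
Proof. by apply: commutator_set_morph => y z;
  rewrite /= /kernel_set /= => -> ->. Qed.

Fact pure_affine x : braid_perm x = 1 -> braid_affine x = ((braid_affine x).1, 1).
Proof. by move=> x1; rewrite [LHS]surjective_pairing braid_affine_perm x1 gmult1. Qed.

Fact braid_affine_commutator x : commutator_subgroup (pure_braid n) x -> braid_affine x = 1.
Proof.
apply: commutator_set_morph => y z /pure_affine py /pure_affine pz /=.
rewrite py pz.
by rewrite (@lp_translateM d) (@lp_translateM d) GRing.addrC.
Qed.

Definition quotient_perm : Q -> 'S_n := quotient_lift braid_perm_commutator.
HB.instance Definition _ := Multiplicative.on quotient_perm.

Definition quotient_affine : Q -> lattice_perm d := quotient_lift braid_affine_commutator.
HB.instance Definition _ := Multiplicative.on quotient_affine.

Lemma quotient_affine_perm (x : Q) : (quotient_affine x).2 = pair_perm (quotient_perm x).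
Proof. exact: braid_affine_perm. Qed.

Lemma quotient_affine_parity (x : Q) (i j : 'I_n) : i != j ->
  (((quotient_affine x).1 ord0 (edge i j))%:~R =
   ((i < j)%N (+) (quotient_perm x i < quotient_perm x j)%N)%:R :> 'F_2)%R.
Proof. exact: braid_affine_parity. Qed.

Lemma pure_commute (x y : Q) : quotient_perm x = 1 -> quotient_perm y = 1 -> x * y = y * x.
Proof.
rewrite -[x]coset_class_repr -[y]coset_class_repr /quotient_perm.
rewrite !quotient_liftE => x1 y1; exact: quotient_commute.
Qed.

Lemma pure_conj (x y : Q) : quotient_perm x = 1 -> quotient_perm y = 1 -> x ^ y = x.
Proof. by move=> x1 y1; rewrite /conjg (pure_commute x1 y1) mulKg. Qed.

End BraidAffine.

(** * Standard generators of the pure braid group *)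

Section BraidQuotient.
Local Open Scope group_scope.
Variable n : nat.
Local Notation d := (pair_dim n).
Local Notation Q := (group_quotient (commutator_subgroup (pure_braid n))).
Local Notation cls := (coset_class (commutator_subgroup (pure_braid n))).
Local Notation qperm := (@quotient_perm n).
Implicit Types x y : Q.

Definition artin_class (i : nat) : Q :=
  if insub i is Some j then cls (braid_gen j) else 1.
Local Notation sig := artin_class.

Lemma artin_class_perm i : qperm (sig i) = sym_gen n i.
Proof.
rewrite /artin_class /sym_gen; case: insubP => [j _ _|_]; last exact: gmult1.
by rewrite /quotient_perm quotient_liftE /= braid_perm_gen.
Qed.

Lemma braid_gen_word (s : seq 'I_n.-1) :
  \prod_(i <- s) braid_gen i = word_class (@braid_rel n) [seq (i, true) | i <- s].
Proof.
elim: s => [|i s IHs]; first by rewrite big_nil.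
rewrite big_cons IHs; exact: presented_mulE.
Qed.

Lemma artin_class_far i j : (i.+1 < j)%N -> sig i * sig j = sig j * sig i.
Proof.
move=> ij; rewrite /artin_class; case: insubP => [i' _ i'E|_];
  last by rewrite mul1g mulg1.
case: insubP => [j' _ j'E|_]; last by rewrite mul1g mulg1.
rewrite -!coset_classM; congr (cls _).
have := braid_gen_word [:: i'; j']; have := braid_gen_word [:: j'; i'].
rewrite !big_cons big_nil !mulg1 => -> ->; apply/word_classP/word_eq_rel.
by apply: braid_far; apply/orP; left; move: i'E j'E => /= -> ->; lia.
Qed.

Lemma artin_class_near i : (i.+1 < n.-1)%N ->
  sig i.+1 * sig i * sig i.+1 = sig i * sig i.+1 * sig i.
Proof.
move=> im; rewrite /artin_class; case: insubP => [j _ jE|]; last by rewrite im.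
case: insubP => [i' _ i'E|]; last by rewrite ltnW.
rewrite -!coset_classM -!mulgA; congr (cls _).
have := braid_gen_word [:: i'; j; i']; have := braid_gen_word [:: j; i'; j].
rewrite !big_cons big_nil !mulg1 => -> ->; apply/word_classP/word_eq_rel.
by apply: braid_near; move: i'E jE => /= -> ->.
Qed.

Lemma artin_class_sqr_pure k : qperm (sig k * sig k) = 1.
Proof. by rewrite gmulfM /= artin_class_perm;
  have [s2 _ _] := sym_gen_coxeter n; exact: s2. Qed.

(** The square of [sig k] is pure, and pure elements commute in [Q]; conjugation by [sig k] is thus
    an involution on them. *)
Lemma conj_artin_class_invol x k : qperm x = 1 -> (x ^ sig k) ^ sig k = x.
Proof. by move=> x1; rewrite -conjgM pure_conj // artin_class_sqr_pure. Qed.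

Lemma artin_class_conjV x k : qperm x = 1 -> x ^ (sig k)^-1 = x ^ sig k.
Proof. by move=> x1; rewrite -{1}(conj_artin_class_invol k x1) conjgK. Qed.

(* The standard generator A_(i,j) of the pure braid group. *)
Definition band i j : Q := (sig i * sig i) ^ word_prod sig (iota i.+1 (j - i.+1)).

Lemma band_pure i j : qperm (band i j) = 1.
Proof. by rewrite gmultJ /= artin_class_sqr_pure conj1g. Qed.

Lemma bandSn i : band i i.+1 = sig i * sig i.
Proof. by rewrite /band subnn /word_prod big_nil conjg1. Qed.

Lemma band_rec i j : (i < j)%N -> band i j.+1 = band i j ^ sig j.
Proof.
move=> ij; rewrite /band -conjgM; congr (_ ^ _).
rewrite (_ : j.+1 - i.+1 = (j - i.+1) + 1)%N; last by lia.
rewrite iotaD word_prod_cat subnKC //.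
by rewrite /= word_prod1.
Qed.

Lemma band_shift i j : (i.+1 < j)%N -> (i.+1 < n.-1)%N ->
  band i.+1 j ^ sig i = band i j.
Proof.
move=> ij im.
(* On pure elements, conjugation by [sig i] and by its inverse agree; with the inverse the identity
   is a form of the braid relation. The remaining letters, from i+2 on, commute with [sig i]. *)
have E : (sig i.+1 * sig i.+1) ^ sig i = (sig i * sig i) ^ sig i.+1.
  rewrite -artin_class_conjV ?artin_class_sqr_pure // !conjMg.
  suff -> : sig i.+1 ^ (sig i)^-1 = sig i ^ sig i.+1 by [].
  rewrite /conjg invgK; apply: (mulgI (sig i.+1)).
  by apply: (mulIg (sig i)); rewrite !mulgA mulgV mul1g mulgKV artin_class_near.
have -> : band i j = ((sig i * sig i) ^ sig i.+1) ^ word_prod sig (iota i.+2 (j - i.+2)).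
  rewrite /band -conjgM; congr (_ ^ _).
  rewrite (_ : j - i.+1 = (j - i.+2).+1)%N; last by lia.
  by rewrite /= -cat1s word_prod_cat word_prod1.
rewrite -E /band -!conjgM; congr (_ ^ _); apply: word_prod_comm => k.
by rewrite mem_iota => /andP[ik _]; apply/esym/artin_class_far.
Qed.

Lemma conjg_fix x y : x * y = y * x -> x ^ y = x.
Proof. by move=> xy; rewrite /conjg xy mulKg. Qed.

Lemma sqr_comm x y : x * y = y * x -> (x * x) * y = y * (x * x).
Proof. by move=> xy; rewrite -mulgA xy !mulgA xy. Qed.

(** Conjugation by [sig k] acts on the ends of a band as the transposition (k, k+1): far letters
    commute with the band, [band_rec] moves the upper end and [band_shift] the lower one, and both
    moves can be reversed because the conjugation is an involution on pure elements. *)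
Lemma band_conj i j k : (i < j < n)%N ->
  exists i' j', (i' < j' < n)%N /\ band i j ^ sig k = band i' j'.
Proof.
move=> /andP[ij jn].
have far_fix : (j < k)%N || (k.+1 < i)%N -> band i j ^ sig k = band i j.
  move=> ijk; apply: conjg_fix; rewrite /band /conjg -!mulgA.
  have w : word_prod sig (iota i.+1 (j - i.+1)) * sig k =
           sig k * word_prod sig (iota i.+1 (j - i.+1)).
    apply: word_prod_comm => l; rewrite mem_iota => lij.
    by case/orP: ijk => ?; [|symmetry]; apply: artin_class_far; lia.
  have si : sig i * sig k = sig k * sig i.
    by case/orP: ijk => ?; [|symmetry]; apply: artin_class_far; lia.
  set v := word_prod _ _ in w *.
  have w' : v^-1 * sig k = sig k * v^-1.
    by apply: (mulgI v); rewrite mulKVg mulgA w mulgK.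
  by rewrite w (mulgA (sig i) (sig k)) si -!mulgA (mulgA (sig i) (sig k)) si -!mulgA mulgA w' -mulgA.
have [kn|kn] := leqP n.-1 k.
  exists i, j; rewrite ij jn; split=> //.
  by rewrite /artin_class insubF ?conjg1 //; lia.
have [kj|jk|kj] := ltngtP k j; last 2 first.
- by exists i, j; rewrite ij jn far_fix // jk.
- by exists i, j.+1; rewrite -kj in ij *; rewrite band_rec //; split=> //; lia.
have [kj1|kj1] := eqVneq k.+1 j.
  rewrite -kj1 in ij jn *; have [ik|ik|ik] := ltngtP i k.
  - exists i, k; rewrite band_rec // conj_artin_class_invol ?band_pure //.
    by split=> //; lia.
  - by exists i, k.+1; rewrite ij jn; move: ij; lia.
  - exists i, k.+1; rewrite ij jn; split=> //; rewrite -ik bandSn.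
    by apply: conjg_fix; rewrite mulgA.
have {kj kj1} kj : (k.+1 < j)%N by lia.
have [ki|ki|ki] := ltngtP k i.
- have [ki1|ki1] := eqVneq k.+1 i.
    exists k, j; split; first lia.
    by rewrite -ki1; apply: band_shift; lia.
  by exists i, j; rewrite ij jn far_fix //; apply/orP; right; lia.
(* Strictly between the ends, the letter [k] slides to the left through the conjugating word; the
   braid relation turns it into k+1, which commutes with [sig i]. *)
- exists i, j; rewrite ij jn; split=> //; rewrite /band -conjgM.
  have [s1 s2] : (k.+1 <= j /\ i < k)%N by lia.
  have -> : iota i.+1 (j - i.+1) = iota i.+1 (k - i.+1) ++ [:: k; k.+1] ++ iota k.+2 (j - k.+2).
    rewrite (_ : j - i.+1 = (k - i.+1) + (2 + (j - k.+2)))%N; last by lia.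
    by rewrite iotaD subnKC.
  set u := iota i.+1 _; set v := iota k.+2 _.
  have uE : word_prod sig u * sig k.+1 = sig k.+1 * word_prod sig u.
    by apply: word_prod_comm => l; rewrite mem_iota => ?;
      apply: artin_class_far; lia.
  have vE : word_prod sig v * sig k = sig k * word_prod sig v.
    by apply: word_prod_comm => l; rewrite mem_iota => ?;
      apply/esym/artin_class_far; lia.
  have wE : word_prod sig (u ++ [:: k; k.+1] ++ v) * sig k =
            sig k.+1 * word_prod sig (u ++ [:: k; k.+1] ++ v).
    have -> : word_prod sig (u ++ [:: k; k.+1] ++ v) =
        word_prod sig u * (sig k * sig k.+1) * word_prod sig v.
      by rewrite !word_prod_cat mulgA -[[:: k; k.+1]]/([:: k] ++ [:: k.+1]) word_prod_cat !word_prod1.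
    rewrite -!mulgA vE !mulgA -uE; congr (_ * _).
    rewrite -!mulgA; congr (_ * _); rewrite !mulgA artin_class_near //; lia.
  rewrite wE conjgM; congr (_ ^ _); apply/conjg_fix/sqr_comm/artin_class_far;
    lia.
- rewrite ki in kj kn *; exists i.+1, j; split; first lia.
  rewrite -(@band_shift i j); try lia.
  by rewrite conj_artin_class_invol ?band_pure.
Qed.

End BraidQuotient.

(** * The bands generate the abelianized pure braid group *)

Section BandSubgroup.
Local Open Scope group_scope.
Variable n : nat.
Local Notation d := (pair_dim n).
Local Notation Q := (group_quotient (commutator_subgroup (pure_braid n))).
Local Notation cls := (coset_class (commutator_subgroup (pure_braid n))).
Local Notation qperm := (@quotient_perm n).
Local Notation sig := (@artin_class n).
Local Notation band := (@band n).
Implicit Types x y : Q.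

Definition band_set : set Q :=
  generated_by [set x | exists i j, (i < j < n)%N /\ x = band i j].

Lemma band_set_pure x : band_set x -> qperm x = 1.
Proof.
elim=> [|_ [i [j [_ ->]]]|y z _ y1 _ z1|y _ y1]; first exact: gmult1.
- exact: band_pure.
- by rewrite gmulfM /= y1 z1 mulg1.
- by rewrite gmultV /= y1 invg1.
Qed.

Lemma artin_class_ord (i : 'I_n.-1) : sig i = cls (braid_gen i).
Proof. by rewrite /artin_class valK. Qed.

Lemma band_setJ x y : band_set x -> band_set (x ^ y).
Proof.
have Jsig z k : band_set z -> band_set (z ^ sig k).
  elim=> [|_ [i [j [ijn ->]]]|u v _ Pu _ Pv|u _ Pu].
  - by rewrite conj1g; exact: generated_one.
  - have [i' [j' [ijn' ->]]] := band_conj k ijn.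
    by apply: generated_incl; exists i', j'.
  - by rewrite conjMg; exact: generated_mul.
  - by rewrite conjVg; exact: generated_inv.
rewrite -[y]coset_class_repr; move: (repr y) => b; move: x.
(* Stability under the inverse is carried along so that the induction passes to inverses of
   braids. *)
suff [] : (forall x, band_set x -> band_set (x ^ cls b)) /\
          (forall x, band_set x -> band_set (x ^ (cls b)^-1)) by [].
elim/braid_ind: b => [|b c [Pb PVb] [Pc PVc]|b [Pb PVb]|i].
- by rewrite gmult1 invg1; split=> x; rewrite conjg1.
- rewrite coset_classM invgM; split=> x bx; rewrite conjgM;
    [exact/Pc/Pb|exact/PVb/PVc].
- by rewrite gmultV invgK.
- rewrite -artin_class_ord; split=> x bx; first exact: Jsig.
  rewrite artin_class_conjV; [exact: Jsig|exact: band_set_pure].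
Qed.

Definition band_subgroup : normal_subgroup Q :=
  @NormalSubgroup Q band_set (@generated_one _ _) (@generated_mul _ _)
    (@generated_inv _ _) band_setJ.
Local Notation bcls := (coset_class band_subgroup).

(** The square of [sig i] is the band of the strands i, i+1, so killing the bands turns the braid
    relations into Coxeter relations. *)
Lemma band_coset_coxeter : coxeter_family (bcls \o sig) n.-1.
Proof.
split=> [i|i j ij|i im] /=.
- rewrite -coset_classM -(gmult1 (coset_class band_subgroup));
    apply/coset_classP; rewrite mulg1.
  apply: generated_inv; have [im|im] := ltnP i n.-1.
    by apply: generated_incl; exists i, i.+1; rewrite bandSn; split=> //; lia.
  by rewrite /artin_class insubF ?mulg1; [exact: generated_one|lia].
- by have /(congr1 bcls) := artin_class_far n ij; rewrite !coset_classM.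
- by have /(congr1 bcls) := artin_class_near im; rewrite !coset_classM.
Qed.

(** One positive word serves for the permutation and for the coset at once. The letters are
    involutions in both groups, so an inverse is represented by the reversed word. *)
Lemma band_coset_word x : exists u, [/\ all (ltn^~ n.-1) u,
  qperm x = word_prod (sym_gen n) u & bcls x = word_prod (bcls \o sig) u].
Proof.
rewrite -[x]coset_class_repr; move: (repr x) => b.
elim/braid_ind: b => [|b c [u [um bu bu']] [v [vm cv cv']]|b [u [um bu bu']]|i].
- by exists [::]; split=> //; rewrite /word_prod big_nil gmult1 // gmult1.
- exists (u ++ v); split; first by rewrite all_cat um.
    by rewrite coset_classM gmulfM /= bu cv word_prod_cat.
  by rewrite !coset_classM bu' cv' word_prod_cat.
- have rev_word (K : groupType) (s : nat -> K) w : coxeter_family s n.-1 ->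
      word_prod s (rev w) = (word_prod s w)^-1.
    move=> [s2 _ _]; elim: w => [|j w IHw];
      first by rewrite /word_prod big_nil invg1.
    rewrite rev_cons -cats1 -[in RHS]cat1s !word_prod_cat invgM IHw !word_prod1.
    by congr (_ * _); apply: (mulgI (s j)); rewrite s2 mulgV.
  exists (rev u); rewrite all_rev; split=> //.
    by rewrite !gmultV /= bu rev_word //; exact: sym_gen_coxeter.
  by rewrite !gmultV /= bu' rev_word //; exact: band_coset_coxeter.
- exists [:: val i]; rewrite /= ltn_ord !word_prod1 /= -artin_class_ord.
  by rewrite artin_class_perm.
Qed.

(** The word of a pure element is trivial in ['S_n], hence trivial modulo the bands by the Coxeter
    presentation. *)
Lemma pure_band_set x : qperm x = 1 -> band_set x.
Proof.
move=> x1; have [u [um xu xu']] := band_coset_word x.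
have : bcls x = bcls 1.
  rewrite gmult1 xu'; apply: (coxeter_presentation band_coset_coxeter um).
  by rewrite -xu.
by move=> /coset_classP/generated_inv; rewrite mulg1 invgK.
Qed.

(** Adjacent transpositions generate: the run from the last point [m] that may move to its image
    agrees with the permutation at [m], and dividing by it leaves a permutation that fixes [m] and
    everything above. *)
Lemma sym_word (w : 'S_n) : exists2 u, all (ltn^~ n.-1) u & w = word_prod (sym_gen n) u.
Proof.
suff main (m : nat) (v : 'S_n) : (m <= n)%N -> (forall i : 'I_n, (m <= i)%N -> v i = i) ->
    exists2 u, all (ltn^~ m.-1) u & v = word_prod (sym_gen n) u.
  apply: (main n w (leqnn n)) => i ni; have := ltn_ord i; lia.
elim: m v => [|m IHm] v mn fix_v.
  by exists [::] => //; rewrite /word_prod big_nil; apply/permP => i;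
    rewrite perm1 fix_v.
pose k := v (Ordinal mn).
have km : (k <= m)%N.
  rewrite leqNgt; apply/negP => mk.
  have /perm_inj kE : v k = v (Ordinal mn) by rewrite fix_v.
  by move: mk; rewrite kE /= ltnn.
pose t := word_prod (sym_gen n) (descent m k).
have tm : t (Ordinal mn) = k.
  by apply/val_inj; rewrite /= descent_sym.
have [u um uE] : exists2 u, all (ltn^~ m.-1) u & v * t^-1 = word_prod (sym_gen n) u.
  apply: IHm; first exact: ltnW.
  move=> i mi; rewrite permM; have [im|im] := eqVneq (nat_of_ord i) m.
    have -> : i = Ordinal mn by apply/val_inj.
    by rewrite -/k -tm permK.
  have vi : v i = i by apply: fix_v; lia.
  rewrite vi; apply: (canLR (permK _)); apply/esym.
  case: (posnP m) => [m0|m0].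
    by rewrite /t (_ : descent m k = [::]) ?/word_prod ?big_nil ?perm1 // /descent m0.
  apply: (@word_prod_sym_fix _ m); last lia.
  by apply/allP => j; rewrite mem_descent => /andP[].
exists (u ++ descent m k); last by rewrite word_prod_cat -uE mulgKV.
rewrite all_cat; apply/andP; split.
  by apply: sub_all um => j /=; lia.
by apply/allP => j; rewrite mem_descent => /andP[].
Qed.

Lemma quotient_perm_surj (w : 'S_n) : exists x, qperm x = w.
Proof.
have [u _ ->] := sym_word w; exists (word_prod sig u).
elim: u => [|i u IHu]; first by rewrite /word_prod !big_nil; exact: gmult1.
by rewrite -cat1s !word_prod_cat !word_prod1 gmulfM /= IHu artin_class_perm.
Qed.

End BandSubgroup.

(** If [w] moves [i], a third point [k] gives the pair {i, k}, whose image contains [w i] and so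
    differs from it. For n = 2 the swap fixes the only pair. *)
Lemma pair_perm_eq1 n (w : 'S_n) : (2 < n)%N -> pair_perm w = 1%g -> w = 1%g.
Proof.
move=> n2 w1; apply/permP => i; rewrite perm1; apply/eqP;
  apply: contraLR n2 => wi.
rewrite -leqNgt -[n]card_ord.
suff sub : [set: 'I_n]%SET \subset [set i; w i]%SET.
  by rewrite -cardsT (leq_trans (subset_leq_card sub)) // cards2;
    case: (_ != _).
apply/fintype.subsetP => k _; rewrite !inE; apply/norP => -[ki kw].
have [|e eE] := @pair_set_surj n [set i; k]%SET;
  first by rewrite cards2 eq_sym ki.
have := pair_permE w e; rewrite w1 perm1 eE imsetU1 imset_set1 => E.
have : w i \in [set i; k]%SET by rewrite E !inE eqxx.
by rewrite !inE (negbTE wi) eq_sym (negbTE kw).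
Qed.

(** * Faithfulness of the affine action and its translation lattice *)

Section BraidCrystal.
Local Open Scope group_scope.
Variables (n : nat) (e0 : 'I_(pair_dim n)).
Local Notation d := (pair_dim n).
Local Notation Q := (group_quotient (commutator_subgroup (pure_braid n))).
Local Notation qperm := (@quotient_perm n).
Local Notation qaff := (quotient_affine e0).
Local Notation edge := (edge e0).
Implicit Types (x y : Q) (e : 'I_d) (a b : 'I_d -> nat).

Lemma artin_class_affine (i : 'I_n.-1) : qaff (artin_class n i) = artin_affine e0 i.
Proof. by rewrite artin_class_ord /quotient_affine quotient_liftE /= braid_affine_gen. Qed.

(** The generator of strands i, i+1 fixes the edge {i, i+1} and translates along it, so its square
    translates by twice the basis vector. Conjugating by the next generator moves the upper end of
    the edge by one. *)
Lemma band_affine (i j : 'I_n) : (i < j)%N ->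
  qaff (band n i j) = ((delta_mx ord0 (edge i j) *+ 2)%R, 1).
Proof.
have neq (k l : 'I_n) : k != l :> nat -> k != l by [].
case: j => j jn; elim: j jn => [//|j IHj] jn /= ij.
have jn1 : (j < n.-1)%N by lia.
pose g := Ordinal jn1.
have [ji|ji] := eqVneq (nat_of_ord i) j.
  have -> : band n i j.+1 = artin_class n g * artin_class n g by rewrite -ji bandSn ji.
  rewrite gmulfM /=. rewrite !(artin_class_affine g) lp_mulE /=.
  have lE : ord_left g = i by apply/val_inj.
  have rE : ord_right g = Ordinal jn by apply/val_inj.
  rewrite adjacent_edge ?lE ?rE; last by apply: neq => /=; lia.
  rewrite /adjacent_tperm lE rE tpermL tpermR [X in (_ + delta_mx _ X)%R]edgeC.
  congr (_, _); rewrite -gmulfM -(gmult1 (@pair_perm n)); congr (pair_perm _).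
  exact: tperm2.
have ij' : (i < j)%N by lia.
rewrite band_rec // gmultJ /= (IHj (ltnW jn) ij') (artin_class_affine g).
rewrite lp_translate_conj /=; congr (_, _).
rewrite GRing.raddfMn /= col_perm_delta invgK pair_perm_edge;
  last by apply: neq => /=; lia.
have -> : adjacent_tperm g i = i.
  by apply/val_inj; rewrite /= adjacent_tpermE /=; (repeat case: ifP); lia.
suff -> : adjacent_tperm g (Ordinal (ltnW jn)) = Ordinal jn by [].
by apply/val_inj; rewrite /= adjacent_tpermE /=; (repeat case: ifP); lia.
Qed.

Definition edge_ends e : 'I_n * 'I_n :=
  let: exist i P := cid (edge_surj e0 e) in (i, sval (cid P)).

Lemma edge_endsP e : ((edge_ends e).1 < (edge_ends e).2)%N /\
  e = edge (edge_ends e).1 (edge_ends e).2.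
Proof. by rewrite /edge_ends; case: cid => i P /=; case: cid. Qed.

Lemma edge_ends_edge (i j : 'I_n) : (i < j)%N -> edge_ends (edge i j) = (i, j).
Proof.
move=> ij; have [lt] := edge_endsP (edge i j);
  case: (edge_ends _) lt => k l /= kl /eqP.
rewrite edge_eq ?neq_ltn ?ij ?kl // => /orP[]/andP[/eqP iE /eqP jE];
  first by rewrite iE jE.
by move: ij; rewrite iE jE; lia.
Qed.

Definition edge_band e : Q := band n (edge_ends e).1 (edge_ends e).2.

Lemma edge_band_affine e : qaff (edge_band e) = ((delta_mx ord0 e *+ 2)%R, 1).
Proof. by have [lt eE] := edge_endsP e;
  rewrite /edge_band band_affine // -eE. Qed.

(** Exponents are natural numbers; a general element of the band subgroup is a quotient of two such
    products, written without inverses as [x * band_prod b = band_prod a]. *)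
Definition band_prod a : Q := \prod_(e < d) edge_band e ^+ a e.

Lemma pureX x k : qperm x = 1 -> qperm (x ^+ k) = 1.
Proof. by move=> x1; rewrite gmultX /= x1 expg1n. Qed.

Lemma pure_prod (r : seq 'I_d) (F : 'I_d -> Q) : (forall e, qperm (F e) = 1) ->
  qperm (\prod_(e <- r) F e) = 1.
Proof.
move=> F1; elim/big_rec: _ => [|e x _ x1]; first exact: gmult1.
by rewrite gmulfM /= F1 x1 mulg1.
Qed.

Lemma edge_band_pure e k : qperm (edge_band e ^+ k) = 1.
Proof. by apply: pureX; exact: band_pure. Qed.

Lemma band_prod_pure a : qperm (band_prod a) = 1.
Proof. by apply: pure_prod => e; exact: edge_band_pure. Qed.

Lemma band_prodM a b : band_prod a * band_prod b = band_prod (fun e => a e + b e)%N.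
Proof.
rewrite /band_prod; elim: (index_enum _) => [|e r IHr];
  first by rewrite !big_nil mulg1.
rewrite !big_cons -IHr expgD -!mulgA; congr (_ * _).
rewrite !mulgA; congr (_ * _); apply: pure_commute; last exact: edge_band_pure.
by apply: pure_prod => f; exact: edge_band_pure.
Qed.

Lemma band_prod_affine a : qaff (band_prod a) = ((\row_e (a e)%:Z *+ 2)%R, 1).
Proof.
transitivity ((\sum_(e < d) (delta_mx ord0 e : 'rV[int]_d) *+ 2 *+ a e)%R, 1 : 'S_d).
  rewrite /band_prod; elim: (index_enum _) => [|e r IHr].
    by rewrite !big_nil gmult1.
  rewrite !big_cons gmulfM /= IHr gmultX /= edge_band_affine.
  by rewrite (@lp_translateX d) (@lp_translateM d).
congr (_, _); apply/rowP => f; rewrite summxE (bigD1 f) //= big1 => [|e ef].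
  rewrite GRing.addr0 !mulmxnE !mxE !eqxx /=.
  by rewrite -GRing.mulrnA natz -GRing.mulr_natr; lia.
by rewrite !mulmxnE mxE eqxx eq_sym (negbTE ef) !GRing.mul0rn.
Qed.

Lemma band_set_prod x : band_set x -> exists a b, x * band_prod b = band_prod a.
Proof.
elim=> [|_ [i [j [/andP[ij jn] ->]]]|y z by_ [a [b abE]] bz [a' [b' abE']]|y by_ [a [b abE]]].
- by exists (fun=> 0%N), (fun=> 0%N); rewrite mul1g.
- have in' : (i < n)%N by lia.
  pose e := edge (Ordinal in') (Ordinal jn).
  exists (fun f => f == e : nat), (fun=> 0%N).
  have -> : band_prod (fun=> 0%N) = 1 by rewrite /band_prod big1.
  rewrite mulg1 /band_prod (@big_only1 _ _ _ _ e) //= => [|f fe _].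
    by rewrite eqxx expg1 /edge_band /e edge_ends_edge.
  by rewrite (negbTE fe).
- exists (fun e => a e + a' e)%N, (fun e => b e + b' e)%N.
  rewrite -!band_prodM -abE -abE' -!mulgA; congr (_ * _); rewrite !mulgA;
    congr (_ * _).
  by apply: pure_commute; [exact: band_set_pure|exact: band_prod_pure].
- by exists b, a; rewrite -abE mulKg.
Qed.

(** A trivial affine map has a trivial permutation of pairs, so [x] is pure and a quotient of two
    products of bands. Their translations 2a and 2b coincide, hence so do the exponents. *)
Lemma quotient_affine_eq1 x : (2 < n)%N -> qaff x = 1 -> x = 1.
Proof.
move=> n2 x1; have px : qperm x = 1.
  by apply: pair_perm_eq1 => //; rewrite -(quotient_affine_perm e0) x1.
have [a [b xab]] := band_set_prod (pure_band_set px).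
have := congr1 qaff xab; rewrite gmulfM /= x1 mul1g !band_prod_affine => -[abE].
suff ab : a = b by apply: (mulIg (band_prod b)); rewrite xab ab mul1g.
apply/funext => e; move: abE => /rowP/(_ e); rewrite !mulmxnE !mxE; lia.
Qed.

Lemma quotient_affine_even (v : 'rV[int]_d) : exists x, qaff x = ((v *+ 2)%R, 1).
Proof.
(* Positive and negative parts of [v]; [Negz k] stands for -(k+1). *)
pose a e := if v ord0 e is Posz k then k else 0%N.
pose b e := if v ord0 e is Negz k then k.+1 else 0%N.
exists (band_prod a * (band_prod b)^-1).
rewrite gmulfM gmultV /= !band_prod_affine (@lp_translateV d) (@lp_translateM d).
congr (_, _); apply/rowP => e; rewrite !mxE /a /b.
by case: (v ord0 e) => k; lia.
Qed.

End BraidCrystal.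

(** * The holonomy cover *)

Section HolonomyCover.
Local Open Scope group_scope.
Variables (n : nat) (n3 : (2 < n)%N) (e0 : 'I_(pair_dim n)).
Local Notation d := (pair_dim n).
Local Notation Q := (group_quotient (commutator_subgroup (pure_braid n))).
Local Notation qperm := (@quotient_perm n).
Local Notation qaff := (quotient_affine e0).

Lemma rV_double_inj (v w : 'rV[int]_d) : (v *+ 2 = w *+ 2)%R -> v = w.
Proof.
move=> vw; apply/rowP => e.
have : (v ord0 e *+ 2 = w ord0 e *+ 2)%R by rewrite -!mulmxnE vw.
by move=> vwe; suff : v ord0 e = w ord0 e by []; lia.
Qed.

Lemma quotient_affine_inj : injective qaff.
Proof. by apply: gmult_inj => x; exact: quotient_affine_eq1. Qed.

Lemma affine_perm_eq1 (x : Q) : (qaff x).2 = 1 -> qperm x = 1.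
Proof. by rewrite quotient_affine_perm; exact: pair_perm_eq1. Qed.

Lemma pure_quotient_affine (x : Q) : qperm x = 1 -> qaff x = ((qaff x).1, 1).
Proof. by move=> x1; rewrite [LHS]surjective_pairing quotient_affine_perm x1 gmult1. Qed.

(** A pure element inverts no pair, so the parity formula makes every coordinate of its translation
    even. *)
Lemma pure_quotient_even (x : Q) : qperm x = 1 ->
  exists v : 'rV[int]_d, qaff x = ((v *+ 2)%R, 1).
Proof.
move=> x1; rewrite (pure_quotient_affine x1).
have even e : exists v : int, ((qaff x).1 ord0 e = v *+ 2)%R.
  have [i [j [ij ->]]] := edge_surj e0 e.
  have := @quotient_affine_parity n e0 x i j;
    rewrite neq_ltn ij x1 !perm1 ij addbb => /(_ isT).
  move=> /eqP; rewrite -(@dvdz_pcharf 'F_2 2) => [/dvdzP[v ->]|];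
    last exact: pchar_Fp.
  by exists v; lia.
pose v e := sval (cid (even e)); exists (\row_e v e)%R; congr (_, _).
by apply/rowP => e; rewrite mulmxnE mxE /v; case: cid.
Qed.

(* An involution of S_n that swaps i and j forces an odd, hence nonzero,
   coordinate on the edge {i, j}; squaring then gives a nonzero translation. *)
Lemma quotient_torsion_free (x : Q) k m : (0 < k)%N -> x ^+ k = 1 ->
  qperm x ^+ (2 ^ m) = 1 -> x = 1.
Proof.
move=> k0; elim: m x => [|m IHm] x xk.
  rewrite expn0 expg1 => x1; apply: quotient_affine_inj; rewrite gmult1.
  have := congr1 qaff xk; rewrite gmultX /= (pure_quotient_affine x1) (@lp_translateX d).
  rewrite gmult1 => -[/rowP v0]; congr (_, _); apply/rowP => e; have := v0 e.
  by rewrite mulmxnE !mxE => /eqP;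
    rewrite Num.Theory.mulrn_eq0 eqn0Ngt k0 /= => /eqP.
(* Either [y] is pure and the induction hypothesis applies, or its permutation is an involution that
   moves some [i], which is shown to be impossible. *)
move=> x2m; pose y := x ^+ (2 ^ m).
have [y1|y1] := eqVneq (qperm y) 1; first by apply: IHm => //;
  rewrite -y1 gmultX.
have yy1 : qperm (y * y) = 1.
  by rewrite -expg2 -expgM -expnSr gmultX.
have yk : (y * y) ^+ k = 1.
  by rewrite -expg2 -!expgM mulnA mulnC expgM xk expg1n.
have [i wi] : exists i, qperm y i != i.
  apply: contrapT => nw; case/eqP: y1; apply/permP => i; rewrite perm1.
  by apply: contrapT => /eqP wi; case: nw; exists i.
pose j := qperm y i.
have wj : qperm y j = i.
  by rewrite /j -permM; have := yy1; rewrite gmulfM /= => ->; rewrite perm1.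
have := @quotient_affine_parity n e0 y i j;
  rewrite eq_sym wi -/j wj => /(_ isT) odd_v.
(* The square of [y] is a torsion translation, hence zero. As [y] preserves the edge {i, j}, the
   coordinate of the square there is twice that of [y]. *)
have v0 : ((qaff y).1 ord0 (edge e0 i j) = 0)%R.
  have := congr1 qaff yk; rewrite gmultX /= (pure_quotient_affine yy1) (@lp_translateX d).
  rewrite gmult1 => -[/rowP/(_ (edge e0 i j))]; rewrite mulmxnE gmulfM /= !mxE.
  rewrite quotient_affine_perm pair_perm_edge 1?eq_sym // -/j wj edgeC.
  by move=> /eqP; rewrite Num.Theory.mulrn_eq0 eqn0Ngt k0 /= -GRing.mulr2n Num.Theory.mulrn_eq0 /= => /eqP.
move: odd_v; rewrite v0 => /eqP; have : (i != j :> nat)%N by rewrite eq_sym.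
by case: ltngtP.
Qed.

Variables (H : finGroupType) (f : {multiplicative H -> 'S_n}).
Hypotheses (f_inj : injective f) (H2 : 2.-group [set: H]%SET).

Definition holonomy_pred : {pred Q} := fun x => `[< exists h, f h = qperm x >].

Fact holonomy_pred_closed : group_closed holonomy_pred.
Proof.
split; first by apply/asboolP; exists 1; rewrite !gmult1.
move=> x y /asboolP[h hx] /asboolP[h' hy]; apply/asboolP; exists (h * h'^-1).
by rewrite !gmulfM !gmultV hx hy.
Qed.

Definition holonomy_cover := {x : Q | holonomy_pred x}.
HB.instance Definition _ := SubChoice.on holonomy_cover.
HB.instance Definition _ :=
  SubChoice_isSubGroup.Build Q holonomy_pred holonomy_cover holonomy_pred_closed.
Local Notation Pi := holonomy_cover.
Implicit Types u : Pi.

Fact holonomy_coverP u : exists h, f h = qperm (val u).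
Proof. exact/asboolP/(valP u). Qed.

Definition cover_holonomy u : H := sval (cid (holonomy_coverP u)).

Lemma cover_holonomyE u : f (cover_holonomy u) = qperm (val u).
Proof. exact: svalP (cid (holonomy_coverP u)). Qed.

Fact cover_holonomyM : {morph cover_holonomy : u v / u * v}.
Proof.
by move=> u v; apply: f_inj; rewrite gmulfM !cover_holonomyE valM gmulfM.
Qed.
HB.instance Definition _ := isMultiplicative.Build Pi H cover_holonomy cover_holonomyM.

Fact val_coverM : {morph (val : Pi -> Q) : u v / u * v}.
Proof. by move=> u v; rewrite valM. Qed.
HB.instance Definition _ := isMultiplicative.Build Pi Q (val : Pi -> Q) val_coverM.

Lemma val_coverX u k : val (u ^+ k) = val u ^+ k.
Proof. exact: (gmultX (val : Pi -> Q)). Qed.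

Lemma val_coverJ u v : val (u ^ v) = val u ^ val v.
Proof. exact: (gmultJ (val : Pi -> Q)). Qed.

Lemma cover_holonomy_eq1 u : cover_holonomy u = 1 <-> qperm (val u) = 1.
Proof.
rewrite -cover_holonomyE; split=> [->|]; first exact: gmult1.
by rewrite -(gmult1 f) => /f_inj.
Qed.

Fact cover_lattice_exists (v : 'rV[int]_d) : exists u : Pi, qaff (val u) = ((v *+ 2)%R, 1).
Proof.
have [x xv] := quotient_affine_even e0 v.
have x1 : qperm x = 1 by apply: affine_perm_eq1; rewrite xv.
have xH : holonomy_pred x by apply/asboolP; exists 1; rewrite x1 gmult1.
by exists (Sub x xH); rewrite SubK.
Qed.

(** The translations in the cover form the lattice 2 Z^d, parametrized here by Z^d. *)
Definition cover_lattice v : Pi := sval (cid (cover_lattice_exists v)).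

Lemma cover_latticeE v : qaff (val (cover_lattice v)) = ((v *+ 2)%R, 1).
Proof. exact: svalP (cid (cover_lattice_exists v)). Qed.

Lemma cover_lattice_perm v : qperm (val (cover_lattice v)) = 1.
Proof. by apply: affine_perm_eq1; rewrite cover_latticeE. Qed.

Lemma holonomy_order u : qperm (val u) ^+ #|H| = 1.
Proof.
rewrite -cover_holonomyE -gmultX -cardsT expg_cardG ?gmult1 //.
by rewrite inE.
Qed.

Lemma cover_torsion_free u k : (0 < k)%N -> u ^+ k = 1 -> u = 1.
Proof.
move=> k0 uk; apply/val_inj; rewrite val1.
have [m Hm] := p_natP H2; apply: (@quotient_torsion_free _ k m) => //.
  by rewrite -val_coverX uk val1.
by rewrite -Hm cardsT holonomy_order.
Qed.

Lemma holonomy_cover_bieberbach : bieberbach d Pi H.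
Proof.
exists cover_lattice, cover_holonomy; split.
- split=> [v w /(congr1 (fun u : Pi => qaff (val u)))|v w].
    by rewrite !cover_latticeE => -[/rV_double_inj].
  apply/val_inj/quotient_affine_inj; rewrite valM gmulfM /= !cover_latticeE.
  by rewrite (@lp_translateM d) GRing.mulrnDl.
- move=> h; have [x xh] := quotient_perm_surj (f h).
  have xH : holonomy_pred x by apply/asboolP; exists h.
  by exists (Sub x xH); apply: f_inj; rewrite cover_holonomyE SubK.
- move=> u; split=> [/cover_holonomy_eq1 u1|[v <-]]; last first.
    by apply/cover_holonomy_eq1; exact: cover_lattice_perm.
  have [v uv] := pure_quotient_even u1.
  by exists v; apply/val_inj/quotient_affine_inj; rewrite uv cover_latticeE.
(* Faithfulness: an element that centralizes the lattice fixes every basis vector, so its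
   permutation of the pairs is trivial. *)
- move=> u fix_u; apply/cover_holonomy_eq1/affine_perm_eq1.
  apply/permP => e; rewrite perm1.
  pose v := delta_mx ord0 e : 'rV[int]_d.
  have : qaff (val (cover_lattice v ^ u)) = qaff (val (cover_lattice v)) by rewrite fix_u.
  rewrite val_coverJ gmultJ /= cover_latticeE lp_translate_conj.
  move=> [/rowP/(_ e)]; rewrite GRing.raddfMn /= /v col_perm_delta invgK !mulmxnE !mxE !eqxx /= eq_sym.
  by case: eqP.
- by move=> u k; exact: cover_torsion_free.
Qed.

End HolonomyCover.

(** * Orbit spaces of crystallographic actions *)

Section PermutedCoordinates.
Import Order.TTheory GRing.Theory Num.Theory numFieldNormedType.Exports.
Local Open Scope classical_set_scope.
Local Open Scope ring_scope.
Variables (R : realType) (d : nat).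
Implicit Types (x y v : 'rV[R]_d) (s : 'S_d).

Lemma rV_norm_le v (c : R) : 0 <= c ->
  (forall j, `|v ord0 j| <= c) -> `|v| <= c.
Proof.
move=> c0 vc; rewrite [leLHS]/Num.norm /= mx_normrE; apply/bigmax_leP.
by split=> // -[i j] _; rewrite ord1; exact: vc.
Qed.

Lemma rV_norm_coord v j : `|v ord0 j| <= `|v|.
Proof.
rewrite [leRHS]/Num.norm /= mx_normrE; apply/bigmax_geP; right.
by exists (ord0, j).
Qed.

Lemma norm_col_perm s v : `|col_perm s v| = `|v|.
Proof.
apply/eqP; rewrite eq_le; apply/andP; split; apply: rV_norm_le => // j.
  by rewrite mxE rV_norm_coord.
rewrite -[in leLHS](permKV s j).
by have := rV_norm_coord (col_perm s v) ((s^-1)%g j); rewrite mxE.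
Qed.

Lemma col_permB s : {morph @col_perm R 1 d s : x y / x - y >-> x - y}.
Proof. by move=> x y; apply/matrixP => i j; rewrite !mxE. Qed.

Lemma rV_connected : connected [set: 'rV[R]_d].
Proof.
pose seg (x : 'rV[R]_d) := (fun t : R => t *: x) @` `[0, 1].
have -> : [set: 'rV[R]_d] = \bigcup_(x in setT) seg x.
  apply/seteqP; split=> // x _; exists x => //; exists 1;
    last by rewrite scale1r.
  by rewrite /= in_itv /= ler01 lexx.
apply: bigcup_connected.
  exists 0 => x _; exists 0; last by rewrite scale0r.
  by rewrite /= in_itv /= ler01 lexx.
move=> x _; apply: connected_continuous_connected.
  exact: segment_connected.
apply: continuous_subspaceT => t; exact: scalel_continuous.
Qed.

End PermutedCoordinates.

(* The norm of 'rV[R]_d is the sup norm, for which permutations of the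
   coordinates are isometries. *)
Record crystal_action (R : realType) (d : nat) := CrystalAction {
  acting :> groupType;
  linear_part : acting -> 'S_d;
  translation_part : acting -> 'rV[R]_d;
  cact g (x : 'rV[R]_d) := (col_perm (linear_part g) x + translation_part g)%R;
  cact1 : forall x, cact 1%g x = x;
  cactM : forall g h x, cact (g * h)%g x = cact g (cact h x);
  displacement : R;
  displacement_gt0 : (0 < displacement)%R;
  displacementP : forall g x, (`|cact g x - x| < displacement)%R -> g = 1%g;
  codiameter : R;
  codiameterP : forall x, exists g, (`|cact g x| <= codiameter)%R }.

Section OrbitSpace.
Import Order.TTheory GRing.Theory Num.Theory numFieldNormedType.Exports.
Local Open Scope classical_set_scope.
Local Open Scope quotient_scope.
Local Open Scope ring_scope.
Variables (R : realType) (d : nat) (A : crystal_action R d).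
Implicit Types (x y z : 'rV[R]_d) (g h : A).

Lemma cactK g : cancel (cact g) (cact (g^-1)%g).
Proof. by move=> x; rewrite -cactM mulVg cact1. Qed.

Lemma cactKV g : cancel (cact (g^-1)%g) (cact g).
Proof. by move=> x; rewrite -cactM mulgV cact1. Qed.

Lemma cact_isometry g x y : `|cact g x - cact g y| = `|x - y|.
Proof. by rewrite /cact opprD addrACA subrr addr0 -col_permB norm_col_perm. Qed.

Lemma cact_continuous g : continuous (cact g).
Proof.
move=> x U /nbhs_ballP[e e0 eU]; apply/nbhs_ballP; exists e => // y xy.
by apply: eU; move: xy; rewrite -!ball_normE /ball_ /= cact_isometry.
Qed.

(** As [h] is an isometry, the distance is the displacement of [x] under the quotient of [g] by
    [h]. *)
Lemma cact_close g h x : `|cact g x - cact h x| < displacement A -> g = h.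
Proof.
rewrite -{1}(cactKV h (cact g x)) cact_isometry -cactM => /displacementP gh.
by apply: (mulgI (h^-1)%g); rewrite gh mulVg.
Qed.

Definition orbit_eqb x y := `[< exists g : A, cact g x = y >].

Fact orbit_eqb_refl : reflexive orbit_eqb.
Proof. by move=> x; apply/asboolP; exists 1%g; rewrite cact1. Qed.

Fact orbit_eqb_sym : symmetric orbit_eqb.
Proof.
by move=> x y; apply/asboolP/asboolP => -[g <-]; exists (g^-1)%g; rewrite cactK.
Qed.

Fact orbit_eqb_trans : transitive orbit_eqb.
Proof.
move=> y x z /asboolP[g <-] /asboolP[h <-]; apply/asboolP.
by exists (h * g)%g; rewrite cactM.
Qed.

Canonical orbit_equiv :=
  EquivRel orbit_eqb orbit_eqb_refl orbit_eqb_sym orbit_eqb_trans.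

Definition orbit_space : topologicalType :=
  quotient_topology {eq_quot orbit_equiv}.

Definition orbit_proj (x : 'rV[R]_d) : orbit_space := \pi_{eq_quot orbit_equiv} x.

Lemma orbit_projP x y : orbit_proj x = orbit_proj y <-> exists g : A, cact g x = y.
Proof. by split=> [/eqmodP /asboolP|xy] //; apply/eqmodP/asboolP. Qed.

Lemma orbit_proj_cact g x : orbit_proj (cact g x) = orbit_proj x.
Proof. by apply/esym/orbit_projP; exists g. Qed.

Lemma orbit_proj_surj (m : orbit_space) : exists x, orbit_proj x = m.
Proof. by exists (repr (m : {eq_quot orbit_equiv})); exact: reprK. Qed.

Lemma orbit_proj_continuous : continuous orbit_proj.
Proof. exact: pi_continuous. Qed.

(** The saturation of [U] is the union of its preimages under all group elements, each of them
    open. *)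
Lemma orbit_proj_open (U : set 'rV[R]_d) : open U -> open (orbit_proj @` U).
Proof.
move=> oU; change (open (orbit_proj @^-1` (orbit_proj @` U))).
have -> : orbit_proj @^-1` (orbit_proj @` U) = \bigcup_(g in [set: A]) (cact g @^-1` U).
  apply/seteqP; split=> [x [y Uy /esym/orbit_projP[g gxy]]|x [g _ /= Ux]].
    by exists g => //=; rewrite gxy.
  by exists (cact g x) => //; rewrite orbit_proj_cact.
by apply: bigcup_open => g _; apply: open_comp => // x _;
  exact: cact_continuous.
Qed.

(** If two orbits cannot be separated, translates of [x] come arbitrarily close to [y]. At most one
    group element brings [x] within half the displacement of [y], so its distance to [y] must
    vanish. *)
Lemma orbit_space_hausdorff : hausdorff_space orbit_space.
Proof.
move=> p q; have [x <-] := orbit_proj_surj p;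
  have [y <-] := orbit_proj_surj q => xy.
have near_orbit (r : R) : 0 < r -> exists g : A, `|cact g x - y| < r.
  move=> r0; have r2 : 0 < r / 2 by rewrite divr_gt0.
  have nb z : nbhs (orbit_proj z) (orbit_proj @` ball z (r / 2)).
    apply: open_nbhs_nbhs; split; first exact/orbit_proj_open/ball_open.
    by exists z => //; exact: ballxx.
  have [_ [[x' xx' <-] [y' yy' /esym/orbit_projP[g gx]]]] := xy _ _ (nb x) (nb y).
  exists g; move: xx' yy'; rewrite -!ball_normE /ball_ /= => xx' yy'.
  rewrite (splitr r); apply: le_lt_trans (ler_distD y' _ _) _.
  by rewrite ltrD // ?[`|y' - y|]distrC // -gx cact_isometry.
have e0 := displacement_gt0 A.
have [|g gx] := near_orbit (displacement A / 2); first by rewrite divr_gt0.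
have [->|neq] := eqVneq y (cact g x); first by rewrite orbit_proj_cact.
have gxy : 0 < `|cact g x - y| by rewrite normr_gt0 subr_eq0 eq_sym.
(* An approximation strictly better than [g], yet close enough to force [h = g]. *)
have [|h hx] := near_orbit (Num.min (displacement A / 2) `|cact g x - y|).
  by rewrite lt_min divr_gt0.
move: hx; rewrite lt_min => /andP[hx hg].
suff hgE : h = g by move: hg; rewrite hgE ltxx.
apply: (@cact_close _ _ x); apply: le_lt_trans (ler_distD y _ _) _.
by rewrite [ltRHS]splitr ltrD // distrC.
Qed.

(** The closed ball whose radius is the codiameter meets every orbit. *)
Lemma orbit_space_compact : compact [set: orbit_space].
Proof.
have -> : [set: orbit_space] = orbit_proj @` [set x | `|x| <= codiameter A].
  apply/seteqP; split=> // m _; have [x <-] := orbit_proj_surj m.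
  by have [g gx] := codiameterP A x; exists (cact g x) => //;
    exact: orbit_proj_cact.
apply: continuous_compact.
  apply: continuous_subspaceT; exact: orbit_proj_continuous.
apply: bounded_closed_compact.
  by exists (codiameter A); split=> [|c cA x /= xA];
    rewrite ?num_real // (le_trans xA) ?ltW.
apply: (@closed_comp _ _ (fun x : 'rV[R]_d => `|x|) [set r | r <= codiameter A]).
  by move=> x _; exact: (@norm_continuous R 'rV[R]_d).
exact: closed_le.
Qed.

Lemma orbit_space_connected : connected [set: orbit_space].
Proof.
have -> : [set: orbit_space] = orbit_proj @` setT.
  by apply/seteqP; split=> // m _; have [x <-] := orbit_proj_surj m; exists x.
apply: connected_continuous_connected; first exact: rV_connected.
apply: continuous_subspaceT; exact: orbit_proj_continuous.
Qed.

End OrbitSpace.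

(** * The flat manifold *)

Section AffineSmooth.
Import Order.TTheory GRing.Theory Num.Theory numFieldNormedType.Exports.
Local Open Scope classical_set_scope.
Local Open Scope ring_scope.
Variables (R : realType) (d : nat).
Implicit Types (x y v : 'rV[R]_d) (f g : 'rV[R]_d -> R) (O : set 'rV[R]_d).

Lemma coord_is_derive (k : 'I_d) (c : R) y v :
  is_derive y v (fun z : 'rV[R]_d => z ord0 k + c) (v ord0 k).
Proof.
have E : (fun h : R => h^-1 *: (((fun z : 'rV[R]_d => z ord0 k + c) \o shift y)
    (h *: v) - (y ord0 k + c))) @ 0^' --> v ord0 k.
  apply: cvg_near_cst; near=> h; rewrite /= !mxE -[_ + _ + c]addrA addrK.
  rewrite /GRing.scale /= mulKf //; near: h.
  exact: nbhs_dnbhs_neq.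
by split; [exact: (cvgP _ E)|exact: cvg_lim].
Unshelve. all: by end_near. Qed.

Lemma partial_coord (i k : 'I_d) (c : R) :
  partial i (fun z : 'rV[R]_d => z ord0 k + c) = fun=> (i == k)%:R.
Proof.
apply/funext => y; rewrite /partial.
rewrite (@derive_val _ _ _ _ _ _ _ (coord_is_derive k c y _)).
by rewrite /basis_vector mxE eqxx eq_sym.
Qed.

Lemma partial_cst (i : 'I_d) (c : R) :
  partial i (fun _ : 'rV[R]_d => c) = fun=> 0.
Proof. by apply/funext => y; rewrite /partial derive_cst. Qed.

Lemma smooth_cst O (c : R) : smooth_on O (fun=> c).
Proof.
move=> s y _; have [e ->] : exists e, partials s (fun _ : 'rV[R]_d => c) = fun=> e.
  elim: s => [|i s [e IHs]]; first by exists c.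
  by exists 0; rewrite /partials /= -/(partials s _) IHs partial_cst.
split=> [|i]; last exact: derivable_cst.
exact: cst_continuous.
Qed.

Lemma smooth_coord O (k : 'I_d) (c : R) :
  smooth_on O (fun z : 'rV[R]_d => z ord0 k + c).
Proof.
(* [foldr] applies the last index of [s] first, and that first derivative is already constant. *)
move=> s y Oy; case/lastP: s => [|s i] /=; last first.
  have -> : partials (rcons s i) (fun z : 'rV[R]_d => z ord0 k + c) =
      partials s (fun=> (i == k)%:R).
    by rewrite /partials foldr_rcons partial_coord.
  exact: smooth_cst.
split=> [|i]; last by have [] := coord_is_derive k c y (basis_vector R i).
apply: (@continuousD R R 'rV[R]_d (fun z : 'rV[R]_d => z ord0 k) (fun=> c)).
  exact: coord_continuous.
exact: cst_continuous.
Qed.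

(** A partial derivative at a point depends only on the values nearby, and [O] is a neighborhood of
    each of its points. *)
Lemma eq_partials O f g (s : seq 'I_d) : open O -> {in O, f =1 g} ->
  {in O, partials s f =1 partials s g}.
Proof.
move=> oO fg; elim: s => [//|i s IHs] y; rewrite inE => Oy /=.
apply: near_eq_derive; near=> z; apply: IHs; rewrite inE; near: z.
exact: open_nbhs_nbhs.
Unshelve. all: by end_near. Qed.

Lemma eq_smooth O f g : open O -> {in O, f =1 g} ->
  smooth_on O g -> smooth_on O f.
Proof.
move=> oO fg gs s y Oy.
have nE : \forall z \near y, partials s g z = partials s f z.
  near=> z; rewrite (eq_partials _ oO fg) // inE; near: z.
  exact: open_nbhs_nbhs.
have [gc gd] := gs s y Oy; split=> [|i]; last exact: near_eq_derivable (gd i).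
have /= gfy := nbhs_singleton nE.
move: gc; rewrite /prop_for /continuous_at gfy; apply: cvg_trans.
apply: (@near_eq_cvg _ _ (nbhs y)).
Unshelve. all: by end_near. Qed.

End AffineSmooth.

Section FlatOrbitSpace.
Import Order.TTheory GRing.Theory Num.Theory numFieldNormedType.Exports.
Local Open Scope classical_set_scope.
Local Open Scope ring_scope.
Variables (R : realType) (d : nat) (A : crystal_action R d).
Local Notation V := 'rV[R]_d.
Local Notation M := (orbit_space A).
Implicit Types (x y z : V) (g h : A) (m : M).

(** With one eighth, two points of a sheet are less than a quarter of the displacement apart, so
    that a sum of two such distances stays below the displacement. *)
Definition chart_radius : R := displacement A / 8.

Lemma chart_radius_gt0 : 0 < chart_radius.
Proof. by rewrite divr_gt0 // displacement_gt0. Qed.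

Definition sheet y : set V := ball y chart_radius.

Definition sheet_dom y : set M := orbit_proj A @` sheet y.

(** The local section of the projection with values in the sheet around [y]; the default [y] occurs
    only off [sheet_dom y]. *)
Definition sheet_inv y m : V := xget y [set x | sheet y x /\ orbit_proj A x = m].

Lemma sheet_dist x y z : sheet y x -> sheet y z -> `|x - z| < displacement A / 4.
Proof.
rewrite /sheet -ball_normE /ball_ /= => yx yz.
have := ler_distD y x z; rewrite [`|x - y|]distrC /chart_radius in yx yz *.
lra.
Qed.

Lemma proj_sheet_inj x y z :
  sheet y x -> sheet y z -> orbit_proj A x = orbit_proj A z -> x = z.
Proof.
move=> yx yz /orbit_projP[g gxz]; have := sheet_dist yx yz.
rewrite distrC -gxz => gx; suff -> : g = 1%g by rewrite cact1.
apply: (@displacementP _ _ _ _ x); apply: lt_trans gx _.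
have := displacement_gt0 A; lra.
Qed.

Lemma proj_sheetK y x : sheet y x -> sheet_inv y (orbit_proj A x) = x.
Proof.
move=> yx; rewrite /sheet_inv; case: xgetP => [z _ [yz zx]|/(_ x)[]//].
exact: (proj_sheet_inj yz yx zx).
Qed.

Lemma sheet_invK y m : sheet_dom y m -> orbit_proj A (sheet_inv y m) = m.
Proof. by case=> x yx <-; rewrite proj_sheetK. Qed.

Lemma sheet_inv_in y m : sheet_dom y m -> sheet y (sheet_inv y m).
Proof. by case=> x yx <-; rewrite proj_sheetK. Qed.

Lemma sheet_center y : sheet y y.
Proof. exact/ballxx/chart_radius_gt0. Qed.

Lemma sheet_open y : open (sheet y).
Proof. exact: ball_open. Qed.

Lemma sheet_dom_open y : open (sheet_dom y).
Proof. exact/orbit_proj_open/sheet_open. Qed.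

Lemma sheet_inv_continuous y m : sheet_dom y m -> {for m, continuous (sheet_inv y)}.
Proof.
case=> x yx <- U; rewrite proj_sheetK // => xU.
have : nbhs x (U `&` sheet y).
  apply: filterI => //; apply: open_nbhs_nbhs; split=> //; exact: sheet_open.
rewrite nbhsE => -[W [oW Wx] WU].
change (nbhs (orbit_proj A x) (sheet_inv y @^-1` U)).
rewrite nbhsE; exists (orbit_proj A @` W).
  by split; [exact: orbit_proj_open|exists x].
by move=> _ [z /WU[Uz yz] <-] /=; rewrite proj_sheetK.
Qed.

Lemma sheet_inv_image y : sheet_inv y @` sheet_dom y = sheet y.
Proof.
apply/seteqP; split=> [_ [m ym <-]|x yx]; first exact: sheet_inv_in.
by exists (orbit_proj A x); [exists x|exact: proj_sheetK].
Qed.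

Lemma sheet_inv_imageI y z : sheet_inv y @` (sheet_dom y `&` sheet_dom z) =
  sheet y `&` (orbit_proj A @^-1` sheet_dom z).
Proof.
apply/seteqP; split=> [_ [m [ym zm] <-]|x [yx zx]].
  by split; [exact: sheet_inv_in|rewrite /= sheet_invK].
by exists (orbit_proj A x); [split=> //; exists x|exact: proj_sheetK].
Qed.

Lemma sheet_overlap_open y z :
  open (sheet_inv y @` (sheet_dom y `&` sheet_dom z)).
Proof.
rewrite sheet_inv_imageI; apply: openI; first exact: sheet_open.
apply: open_comp => [x _|]; first exact: orbit_proj_continuous.
exact: sheet_dom_open.
Qed.

(** One group element serves the whole overlap, connected or not: two candidates send a point of it
    to points less than half the displacement apart, hence coincide. *)
Lemma transition_cact y z : exists g, forall x,
  (sheet_inv y @` (sheet_dom y `&` sheet_dom z)) x ->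
  sheet_inv z (orbit_proj A x) = cact g x.
Proof.
rewrite sheet_inv_imageI.
have lift x : (sheet y `&` (orbit_proj A @^-1` sheet_dom z)) x ->
    exists g, sheet z (cact g x) /\ sheet_inv z (orbit_proj A x) = cact g x.
  move=> [yx /= [t zt tx]]; have [g gx] := (orbit_projP A x t).1 (esym tx).
  by exists g; rewrite gx -tx proj_sheetK.
have [[x0 Ox0]|noO] := pselect (exists x,
  (sheet y `&` (orbit_proj A @^-1` sheet_dom z)) x); last first.
  by exists 1%g => x Ox; case: noO; exists x.
have [g [zg _]] := lift _ Ox0; exists g => x Ox.
have [h [zh ->]] := lift _ Ox; suff -> : h = g by [].
apply: (@cact_close _ _ _ _ _ x).
have := sheet_dist zh zg; have := sheet_dist Ox0.1 Ox.1.
rewrite -(cact_isometry g x0 x);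
  have := ler_distD (cact g x0) (cact h x) (cact g x);
    have := displacement_gt0 A.
lra.
Qed.

Lemma cact_coordE g x (j : 'I_d) :
  cact g x ord0 j = x ord0 (linear_part g j) + translation_part g ord0 j.
Proof. by rewrite /cact !mxE. Qed.

Fact flat_transition_smooth y z (j : 'I_d) :
  smooth_on (sheet_inv y @` (sheet_dom y `&` sheet_dom z))
    (fun x => sheet_inv z (orbit_proj A x) ord0 j).
Proof.
have [g gP] := transition_cact y z.
apply: eq_smooth (smooth_coord (linear_part g j) (translation_part g ord0 j)).
  exact: sheet_overlap_open.
by move=> x; rewrite inE => /gP ->; rewrite cact_coordE.
Qed.

Fact flat_metric_posdef (v : V) :
  v != 0 -> 0 < (v *m (1%:M : 'M[R]_d) *m v^T) ord0 ord0.
Proof.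
move=> v0; rewrite mulmx1 mxE;
  have vv j : v ord0 j * v^T j ord0 = v ord0 j ^+ 2.
  by rewrite mxE expr2.
rewrite lt0r sumr_ge0 ?andbT; last by move=> j _; rewrite vv sqr_ge0.
apply: contra v0; rewrite psumr_eq0; last by move=> j _; rewrite vv sqr_ge0.
move=> /allP vz; apply/eqP/rowP => j; have := vz j (mem_index_enum _).
by rewrite vv sqrf_eq0 mxE => /eqP.
Qed.

(** Transitions are affine with a permutation matrix as Jacobian, which is orthogonal. *)
Fact flat_metric_compatible y z x :
  (sheet_inv y @` (sheet_dom y `&` sheet_dom z)) x ->
  let J := \matrix_(i, j)
    partial i (fun t => sheet_inv z (orbit_proj A t) ord0 j) x in
  (1%:M : 'M[R]_d) = J *m 1%:M *m J^T.
Proof.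
move=> Ox J; have [g gP] := transition_cact y z.
have -> : J = (perm_mx (linear_part g))^T.
  apply/matrixP => i j; rewrite !mxE.
  rewrite -[LHS](@eq_partials _ _ _ (fun t => t ord0 (linear_part g j)
    + translation_part g ord0 j) _ [:: i] (@sheet_overlap_open y z)).
  - by rewrite /= partial_coord eq_sym.
  - by move=> t; rewrite inE => /gP ->; rewrite cact_coordE.
  - by rewrite inE.
by rewrite mulmx1 trmxK tr_perm_mx -perm_mxM mulVg perm_mx1.
Qed.

(** Charts are indexed by the centers of the sheets: the chart map is the local section, its inverse
    is the projection, and the metric is the identity matrix throughout. *)
Definition flat_orbit_manifold : closed_riemannian R d.
Proof.
refine (@ClosedRiemannian R d M (@orbit_space_hausdorff _ _ A)
  (@orbit_space_compact _ _ A) (@orbit_space_connected _ _ A) V sheet_dom sheet_inv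
  (fun=> orbit_proj A) _ sheet_dom_open _ sheet_invK _ _ flat_transition_smooth
  (fun _ _ => 1%:M) _ _ _ flat_metric_compatible).
- by move=> m; have [x <-] := orbit_proj_surj m; exists x, x => //;
    exact: sheet_center.
- by move=> y; rewrite sheet_inv_image; exact: sheet_open.
- move=> y; apply/continuous_in_subspaceT => m; rewrite inE;
    exact: sheet_inv_continuous.
- move=> y; apply: continuous_subspaceT; exact: orbit_proj_continuous.
- by move=> y i j; exact: smooth_cst.
- by move=> y x _; rewrite trmx1.
- by move=> y x _ v; exact: flat_metric_posdef.
Defined.

Lemma flat_orbit_manifold_flat : flat flat_orbit_manifold.
Proof.
move=> y x _ l k i j.
have c0 a b c : christoffel (@metric _ _ flat_orbit_manifold y) a b c = fun=> 0.
  apply/funext => t; rewrite /christoffel /= big1 ?mulr0 // => e _.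
  by rewrite !partial_cst addr0 subr0 mulr0.
rewrite /riemann_tensor !c0 !partial_cst subrr add0r big1 // => e _.
by rewrite !c0 mulr0 subrr.
Qed.

End FlatOrbitSpace.

(** * Fundamental group of the orbit space *)

Section Clamp.
Import Order.TTheory GRing.Theory Num.Theory numFieldNormedType.Exports.
Local Open Scope classical_set_scope.
Local Open Scope ring_scope.

(** Applied with [clamp], this turns continuity within the unit interval or square into continuity
    everywhere. *)
Lemma within_comp_continuous (X Y T : topologicalType) (D : set X) (f : X -> T)
    (c : Y -> X) : {within D, continuous f} -> continuous c ->
  (forall y, D (c y)) -> continuous (f \o c).
Proof.
move=> /subspace_continuousP cf cc Dc y U /= fU.
have cyU : within D (nbhs (c y)) (f @^-1` U) by exact: (cf _ (Dc y)).
by apply: (@filterS _ (nbhs y) _ _ _ _ (cc y _ cyU)) => z /=; apply; exact: Dc.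
Qed.

Variable R : realType.
Implicit Types a b t : R.

Lemma continuous_add (T : topologicalType) (V : normedModType R) (f g : T -> V) :
  continuous f -> continuous g -> continuous (fun u => f u + g u).
Proof. by move=> cf cg t; apply: cvgD; [exact: cf|exact: cg]. Qed.

Lemma continuous_sub (T : topologicalType) (V : normedModType R) (f g : T -> V) :
  continuous f -> continuous g -> continuous (fun u => f u - g u).
Proof. by move=> cf cg t; apply: cvgB; [exact: cf|exact: cg]. Qed.

Lemma continuous_scale (T : topologicalType) (V : normedModType R)
    (k : T -> R) (f : T -> V) :
  continuous k -> continuous f -> continuous (fun u => k u *: f u).
Proof. by move=> ck cf t; apply: cvgZ; [exact: ck|exact: cf]. Qed.

Definition clamp a b t := Num.max a (Num.min b t).

Lemma clamp_continuous a b : continuous (clamp a b).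
Proof.
move=> t; apply: (@continuous_max R R (fun=> a)); first exact: cst_continuous.
by apply: (@continuous_min R R (fun=> b));
  [exact: cst_continuous|exact: cvg_id].
Qed.

Lemma clamp_itv a b t : a <= b -> a <= clamp a b t <= b.
Proof. by move=> ab; rewrite /clamp le_max lexx /= ge_max ab ge_min lexx. Qed.

Lemma clamp_id a b t : a <= t <= b -> clamp a b t = t.
Proof. by case/andP => at_ tb; rewrite /clamp min_r // max_r. Qed.

Lemma clamp_le a b t : t <= a -> a <= b -> clamp a b t = a.
Proof. by move=> ta ab; rewrite /clamp min_r ?max_l // (le_trans ta). Qed.

End Clamp.

Section Lifting.
Import Order.TTheory GRing.Theory Num.Theory numFieldNormedType.Exports.
Local Open Scope classical_set_scope.
Local Open Scope ring_scope.
Variables (R : realType) (d : nat) (A : crystal_action R d).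
Local Notation V := 'rV[R]_d.
Local Notation M := (orbit_space A).
Implicit Types (x y z : V) (g h : A) (m : M) (a b t : R).

(** The lift is continuous on the whole line although it covers [p] only on [0, a]; this allows
    gluing without subspace topologies. *)
Definition lifts_upto a (p : R -> M) (f : R -> V) :=
  continuous f /\ forall t, 0 <= t <= a -> orbit_proj A (f t) = p t.

(** Near [c] the path stays over one sheet, whose section lifts it, and a group element aligns this
    with the given lift at [a]. The bound [e] depends on [c] only, as the supremum argument for
    [path_lift] requires. *)
Lemma lift_step (p : R -> M) c : continuous p ->
  exists2 e : R, 0 < e & forall a b f, `|c - a| < e -> `|c - b| < e ->
    0 <= a <= b -> lifts_upto a p f ->
    exists2 f', f' 0 = f 0 & lifts_upto b p f'.
Proof.
move=> cp; have [y yc] := orbit_proj_surj (p c).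
have : nbhs c (p @^-1` sheet_dom y).
  apply: cp; apply: open_nbhs_nbhs; split; first exact: sheet_dom_open.
  by exists y => //; exact: sheet_center.
move=> /nbhs_ballP[e e0 eU]; exists e => // a b f ca cb /andP[a0 ab] [cf pf].
have pU t : p (clamp a b t) \in sheet_dom y.
  rewrite inE; apply: eU; have /andP[] := clamp_itv t ab.
  move: (clamp a b t) => u au ub; move: ca cb.
  rewrite -ball_normE /ball_ /= !ltr_distl => /andP[? ?] /andP[? ?].
  lra.
pose l t := sheet_inv y (p (clamp a b t)).
have pl t : orbit_proj A (l t) = p (clamp a b t).
  by apply: sheet_invK; rewrite -inE.
have cl : continuous l.
  move=> t; apply: (@continuous_comp _ _ _ (fun u => p (clamp a b u))).
    by apply: continuous_comp; [exact: clamp_continuous|exact: cp].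
  by apply: sheet_inv_continuous; rewrite -inE.
have la t : t <= a -> l t = l a by move=> ta; rewrite /l !clamp_le.
have [g gl] : exists g : A, cact g (l a) = f a.
  by apply/orbit_projP; rewrite pl clamp_le // pf // a0 lexx.
(* Gluing by a sum: up to [a] the last two terms cancel, and beyond [a] the first and the last
   do. *)
exists (fun t => f (Num.min t a) + cact g (l t) - f a).
  by rewrite min_l // la // gl addrK.
split=> [t|t /andP[t0 tb]]; last first.
  have [ta|at_] := leP t a; first by rewrite la // gl addrK pf // t0.
  by rewrite addrAC subrr add0r orbit_proj_cact pl clamp_id // ltW.
apply: continuous_sub => [|u]; last exact: cst_continuous.
apply: continuous_add => u; apply: continuous_comp.
- by apply: (@continuous_min R R id); [exact: cvg_id|exact: cst_continuous].
- exact: cf.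
- exact: cl.
- exact: cact_continuous.
Qed.

(** Let S be the set of times up to which a lift exists. A step at its supremum reaches beyond it,
    unless the supremum is 1, in which case the step reaches 1. *)
Lemma path_lift (p : R -> M) x : continuous p -> orbit_proj A x = p 0 ->
  exists2 f, f 0 = x & lifts_upto 1 p f.
Proof.
move=> cp px.
pose S := [set a : R | 0 <= a <= 1 /\ exists2 f, f 0 = x & lifts_upto a p f].
have S0 : S 0.
  split; first by rewrite lexx ler01.
  exists (fun=> x) => //; split=> [t|t]; first exact: cst_continuous.
  by rewrite -eq_le => /eqP <-.
have supS : has_sup S.
  by split; [exists 0|exists 1 => a [/andP[]]].
have [e e0 eS] := lift_step (sup S) cp.
have [a [/andP[a0 a1] [f fx pf]] ea] := sup_adherent e0 supS.
have aS : a <= sup S.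
  by apply: sup_upper_bound => //; split; [rewrite a0|exists f].
pose b := Num.min 1 (sup S + e / 2).
have S1 : sup S <= 1 by apply: ge_sup; [exists 0|move=> c [/andP[]]].
have bS : sup S <= b by rewrite /b le_min S1 lerDl divr_ge0 // ltW.
have be : b <= sup S + e / 2 by rewrite /b ge_min lexx orbT.
have b1 : b <= 1 by rewrite /b ge_min lexx.
have [|||f' f'x pf'] := eS a b f _ _ _ pf.
- by rewrite ltr_distl; apply/andP; split; lra.
- by rewrite ltr_distl; apply/andP; split; lra.
- by rewrite a0 (le_trans aS).
have Sb : S b.
  by split; [rewrite (le_trans a0 (le_trans aS bS))|exists f'; rewrite // f'x].
have := sup_upper_bound supS Sb.
rewrite {1}/b ge_min => /orP[S1'|]; last lra.
have E : b = 1 by lra.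
by exists f'; rewrite ?f'x // -E.
Qed.

(** Holds for two lifts of one path and also for lifts of nearby paths, so the same estimate gives
    uniqueness of the endpoint and its invariance under homotopy. *)
Definition orbits_close (f f' : R -> V) := forall t, 0 <= t <= 1 ->
  exists g : A, `|cact g (f' t) - f t| < displacement A / 4.

(* Where it is less than 3/4 of the minimal displacement, the distance between
   the two lifts is less than 1/4 of it, and it depends continuously on t. *)
Lemma lift_close (f f' : R -> V) : continuous f -> continuous f' ->
  f 0 = f' 0 -> orbits_close f f' ->
  forall t, 0 <= t <= 1 -> `|f t - f' t| < displacement A / 4.
Proof.
move=> cf cf' f0 ff' t /andP[t0 t1]; have e0 := displacement_gt0 A.
pose N u := `|f u - f' u|.
have cN : continuous N.
  move=> u; apply: continuous_comp; last exact: (@norm_continuous R V).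
  exact: continuous_sub.
have gap u : 0 <= u <= 1 -> N u < 3 / 4 * displacement A ->
    N u < displacement A / 4.
  move=> u01 Nu; have [g gu] := ff' u u01.
  suff g1 : g = 1%g by move: gu; rewrite g1 cact1 distrC.
  apply: (@displacementP _ _ _ _ (f' u)).
  have := ler_distD (f u) (cact g (f' u)) (f' u); rewrite /N in Nu; lra.
apply: (gap t); first by rewrite t0.
rewrite ltNge; apply/negP => Nt.
(* Half the displacement would be attained, inside the range between one and three quarters excluded
   by [gap]. *)
have [||u] := @IVT R N 0 t (displacement A / 2) t0.
- exact: continuous_subspaceT.
- rewrite /N f0 subrr normr0 -/(N t) min_l ?max_r ?normr_ge0 //.
  lra.
rewrite in_itv /= => /andP[u0 ut] Nu.
have := gap u; rewrite u0 (le_trans ut t1) Nu => /(_ isT).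
by have lt : displacement A / 2 < 3 / 4 * displacement A;
  [lra|move=> /(_ lt); lra].
Qed.

Definition base : M := orbit_proj A 0.

(** The deck transformation of the loop, read off from the endpoint of its lift at 0; for a loop the
    default is never reached. *)
Definition loop_class (p : R -> M) : A := xget 1%g [set g |
  exists f, [/\ lifts_upto 1 p f, f 0 = 0 & f 1 = cact g 0]].

Lemma ends_close_eq (f f' : R -> V) g h : continuous f -> continuous f' ->
  f 0 = f' 0 -> orbits_close f f' -> f 1 = cact g 0 -> f' 1 = cact h 0 -> g = h.
Proof.
move=> cf cf' ff'0 ff' fg f'h; apply: (@cact_close _ _ _ _ _ 0).
rewrite -fg -f'h; apply: lt_trans (lift_close cf cf' ff'0 ff' _) _.
  by rewrite ler01 lexx.
have := displacement_gt0 A; lra.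
Qed.

Lemma loop_classE (p : R -> M) f g : lifts_upto 1 p f -> f 0 = 0 ->
  f 1 = cact g 0 -> loop_class p = g.
Proof.
move=> [cf pf] f0 f1; rewrite /loop_class; case: xgetP => [h _|/(_ g)[]];
  last first.
  by exists f.
move=> [f' [[cf' pf'] f'0 f'1]].
apply: ends_close_eq cf' cf _ _ f'1 f1; first by rewrite f'0.
move=> t t01; have [h' h'E] : exists h' : A, cact h' (f t) = f' t.
  by apply/orbit_projP; rewrite pf // pf'.
by exists h'; rewrite h'E subrr normr0 divr_gt0 // displacement_gt0.
Qed.

Lemma loop_classP (p : R -> M) : is_loop base p ->
  exists f, [/\ lifts_upto 1 p f, f 0 = 0 & f 1 = cact (loop_class p) 0].
Proof.
move=> [cp p0 p1].
have [||f f0 [cf pf]] := @path_lift (p \o clamp 0 1) 0.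
- apply: within_comp_continuous cp _ _; first exact: clamp_continuous.
  by move=> t; rewrite /= in_itv; exact: clamp_itv.
- by rewrite /= clamp_id ?lexx ?ler01 // p0.
have {}pf : lifts_upto 1 p f.
  by split=> // t t01; rewrite pf //= clamp_id.
have [g gf] : exists g : A, cact g 0 = f 1.
  by apply/orbit_projP; rewrite pf.2 ?p1 // ler01 lexx.
by exists f; rewrite (loop_classE pf f0 (esym gf)).
Qed.

Lemma loop_class_cat (p q : R -> M) : is_loop base p -> is_loop base q ->
  loop_class (loop_cat p q) = (loop_class p * loop_class q)%g.
Proof.
move=> /loop_classP[f [[cf pf] f0 f1]] /loop_classP[f' [[cf' pf'] f'0 f'1]].
set g := loop_class p in f1 *; set h := loop_class q in f'1 *.
(* The lift of [p] followed by the [g]-translate of the lift of [q]. The minimum and the maximum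
   freeze the inactive term at [cact g 0], which is subtracted. *)
pose k (t : R) : V := f (Num.min (2 * t) 1) + cact g (f' (Num.max (2 * t - 1) 0)) - cact g 0.
have c2 : continuous (fun t : R => 2 * t) by exact: mulrl_continuous.
apply: (@loop_classE _ k).
- split=> [|t /andP[t0 t1]].
    apply: continuous_sub => [|t]; last exact: cst_continuous.
    apply: continuous_add => t; apply: continuous_comp;
      last exact: cact_continuous.
    + by apply: (@continuous_min R R (fun t => 2 * t));
        [exact: c2|exact: cst_continuous].
    + exact: cf.
    apply: continuous_comp; last exact: cf'.
    apply: (@continuous_max R R (fun t => 2 * t - 1));
      last exact: cst_continuous.
    by apply: continuous_sub => // u; exact: cst_continuous.
  rewrite /k /loop_cat; case: leP => t2.
    by rewrite min_l ?max_r ?f'0 ?addrK ?pf //; lra.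
  have -> : Num.min (2 * t) 1 = 1 by rewrite min_r //; lra.
  have -> : Num.max (2 * t - 1) 0 = 2 * t - 1 by rewrite max_l //; lra.
  by rewrite f1 addrAC subrr add0r orbit_proj_cact pf' //; lra.
- by rewrite /k mulr0 min_l ?ler01 // max_r ?f0 ?f'0 ?addrK // sub0r oppr_le0.
- have -> : k 1 = f 1 + cact g (f' 1) - cact g 0.
    have E : 2 - 1 = 1 :> R by lra.
    by rewrite /k mulr1 E min_r ?ler1n // max_l ?ler01.
  by rewrite f1 addrAC subrr add0r f'1 cactM.
Qed.

(** Lifts with common endpoints are joined by the straight-line homotopy, which keeps both ends
    fixed and is then projected. *)
Lemma loop_class_homotopic (p q : R -> M) : is_loop base p -> is_loop base q ->
  loop_class p = loop_class q -> loop_homotopic base p q.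
Proof.
move=> /loop_classP[f [[cf pf] f0 f1]] /loop_classP[f' [[cf' pf'] f'0 f'1]] pq.
exists (fun u : R * R => orbit_proj A (f u.2 + u.1 *: (f' u.2 - f u.2))); split.
- apply: continuous_subspaceT => u.
  apply: continuous_comp; last exact: orbit_proj_continuous.
  have c2 (k : R -> V) : continuous k -> continuous (fun v : R * R => k v.2).
    by move=> ck v; apply: continuous_comp; [exact: cvg_snd|exact: ck].
  apply: continuous_add; first exact: c2.
  apply: continuous_scale => [v|]; first exact: cvg_fst.
  by apply: continuous_sub; exact: c2.
- move=> t; rewrite in_itv /= => t01.
  by rewrite scale0r addr0 scale1r addrC subrK pf ?pf'.
- move=> s _; rewrite /= f0 f'0 f1 f'1 pq !subrr scaler0 !addr0.
  by rewrite orbit_proj_cact.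
Qed.

End Lifting.

(** * Homotopy invariance of the loop class *)

Section FundamentalGroupOrbitSpace.
Import Order.TTheory GRing.Theory Num.Theory numFieldNormedType.Exports.
Local Open Scope classical_set_scope.
Local Open Scope ring_scope.
Variables (R : realType) (d : nat) (A : crystal_action R d).
Local Notation V := 'rV[R]_d.
Local Notation M := (orbit_space A).

Lemma continuous_pair (X Y Z : topologicalType) (f : X -> Y) (g : X -> Z) :
  continuous f -> continuous g -> continuous (fun x => (f x, g x)).
Proof.
move=> cf cg x; have fx := @nbhs_filter _ x.
have ffx := @nbhs_filter _ (f x); have fgx := @nbhs_filter _ (g x).
exact: (@cvg_pair _ _ _ (nbhs x) _ _ fx ffx fgx f g (cf x) (cg x)).
Qed.

(** The indicator of [c s = c 0] is continuous with values 0 and 1 only, so it cannot take the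
    intermediate value 1/2. *)
Lemma locally_constant_segment (T : eqType) (c : R -> T) :
  (forall s, \forall s' \near s, c s' = c s) -> c 0 = c 1.
Proof.
move=> cc; apply/eqP/negPn/negP => c01.
pose u s : R := (c s == c 0)%:R.
have cu : continuous u.
  move=> s; have fs : Filter (nbhs s) by exact: nbhs_filter.
  apply: cvg_trans (@cvg_cst _ (u s) _ (nbhs s) fs).
  apply: (@near_eq_cvg _ _ (nbhs s)).
  by apply: filterS (cc s) => s' E; rewrite /u E.
have [||r _] := @IVT R u 0 1 2^-1 ler01.
- by apply: continuous_subspaceT => r; exact: cu.
- rewrite /u eqxx eq_sym (negbTE c01) min_r ?max_l ?ler01 //.
  by rewrite invr_ge0 ler0n invf_le1 ?ltr0n // ler1n.
by rewrite /u; case: (_ == _) => /=; lra.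
Qed.

(** By compactness of the unit interval, for [s'] near [s] the two loops lie at every time over a
    common sheet. Their lifts then have close orbits and end at the same translate of 0. *)
Lemma loop_class_near (h : R -> R -> M) s :
  continuous (fun u : R * R => h u.1 u.2) -> (forall s', is_loop (base A) (h s')) ->
  \forall s' \near s, loop_class (h s') = loop_class (h s).
Proof.
move=> ch hl.
pose P s' t := exists y, sheet_dom y (h s' t) /\ sheet_dom y (h s t).
have : \forall s' \near s, `[0, 1]%classic `<=` P s'.
  apply: ((compact_near_coveringP _).1 (@segment_compact R 0 1)
    _ (nbhs s) P) => t _.
  have [y yh] := orbit_proj_surj (h s t).
  have : nbhs (s, t) ((fun u : R * R => h u.1 u.2) @^-1` sheet_dom y).
    apply: ch; apply: open_nbhs_nbhs; split; first exact: sheet_dom_open.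
    by exists y => //; exact: sheet_center.
  case=> -[B C] /= [sB tC] BC; exists (C, B) => //= -[t' s'] /= [Ct' Bs'].
  exists y; split; first exact: (BC (s', t')).
  by apply: (BC (s, t')); split=> //; exact: nbhs_singleton sB.
apply: filterS => s' close.
have [f [[cf pf] f0 f1]] := loop_classP (hl s').
have [f' [[cf' pf'] f'0 f'1]] := loop_classP (hl s).
apply: ends_close_eq cf cf' _ _ f1 f'1; first by rewrite f0.
move=> t t01; have [|y [[z yz zt] [z' yz' z't]]] := close t;
  first by rewrite /= in_itv.
have [a az] : exists a : A, cact a z = f t by apply/orbit_projP; rewrite pf.
have [b bz'] : exists b : A, cact b z' = f' t by apply/orbit_projP; rewrite pf'.
(* This element carries [f' t] to [cact a z'], while [f t] is [cact a z], and [z], [z'] share a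
   sheet. *)
exists (a * b^-1)%g; rewrite -az -bz' cactM cactK cact_isometry.
exact: sheet_dist yz' yz.
Qed.

Lemma homotopic_loop_class (p q : R -> M) : is_loop (base A) p ->
  is_loop (base A) q -> loop_homotopic (base A) p q -> loop_class p = loop_class q.
Proof.
move=> lp lq [h [ch hpq hx]].
have c01 (t : R) : clamp 0 1 t \in `[0, 1] by rewrite in_itv; exact: clamp_itv.
(* The homotopy is extended to the plane by clamping both parameters, so that [H s] is a loop for
   every real [s]. *)
pose H s t := h (clamp 0 1 s, clamp 0 1 t).
have cH : continuous (fun u : R * R => H u.1 u.2).
  apply: (@within_comp_continuous _ _ _ _ h
    (fun u : R * R => (clamp 0 1 u.1, clamp 0 1 u.2))) ch _ _ => [|u].
    by apply: continuous_pair => u; apply: continuous_comp;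
      [exact: cvg_fst|exact: clamp_continuous|exact: cvg_snd|exact: clamp_continuous].
  by split; exact: c01.
have id0 : clamp 0 1 0 = 0 :> R by rewrite clamp_id // lexx ler01.
have id1 : clamp 0 1 1 = 1 :> R by rewrite clamp_id // ler01 lexx.
have lH s : is_loop (base A) (H s).
  have [h0 h1] := hx _ (c01 s); split; rewrite /H ?id0 ?id1 //.
  apply: continuous_subspaceT => t.
  apply: (@continuous_comp _ _ _ (fun t => (s, t)) (fun u : R * R => H u.1 u.2)).
    by apply: continuous_pair => u; [exact: cvg_cst|exact: cvg_id].
  exact: cH.
have HE (r : R -> M) s : is_loop (base A) r ->
    (forall t, t \in `[0, 1] -> H s t = r t) -> loop_class (H s) = loop_class r.
  move=> /loop_classP[f [[cf rf] f0 f1]] rH; apply: loop_classE f0 f1.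
  by split=> // t t01; rewrite rf // rH // in_itv.
rewrite -(HE _ 0 lp) -?(HE _ 1 lq) => [|t t01|t t01].
- apply: (@locally_constant_segment _ (fun s => loop_class (H s))) => s.
  exact: loop_class_near.
- by rewrite /H id1 clamp_id ?(proj2 (hpq _ t01)) //; rewrite in_itv in t01.
- by rewrite /H id0 clamp_id ?(proj1 (hpq _ t01)) //; rewrite in_itv in t01.
Qed.

Lemma orbit_space_pi1 : is_pi1 R (base A) A.
Proof.
exists (@loop_class R d A); split.
- exact: loop_class_cat.
- move=> p q lp lq; split; first exact: loop_class_homotopic.
  exact: homotopic_loop_class.
(* Surjectivity: the segment from 0 to its translate projects to a loop of class [g]. *)
- move=> g; pose f (t : R) : V := t *: cact g 0.
  have f0 : f 0 = 0 by rewrite /f scale0r.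
  have f1 : f 1 = cact g 0 by rewrite /f scale1r.
  have cf : continuous f by move=> t; exact: scalel_continuous.
  exists (@orbit_proj _ _ A \o f); last by apply: (loop_classE (f := f)).
  split; rewrite /= ?f0 ?f1 ?orbit_proj_cact //.
  apply: continuous_subspaceT => t; apply: continuous_comp; first exact: cf.
  exact: orbit_proj_continuous.
Qed.

End FundamentalGroupOrbitSpace.

(** * The crystallographic action of the holonomy cover *)

Section HolonomyCoverAction.
Import Order.TTheory GRing.Theory Num.Theory.
Local Open Scope ring_scope.
Variables (R : realType) (n : nat) (n3 : (2 < n)%N) (e0 : 'I_(pair_dim n)).
Variables (H : finGroupType) (f : {multiplicative H -> 'S_n}).
Hypothesis H2 : (2.-group [set: H]%SET)%g.
Local Notation d := (pair_dim n).
Local Notation qaff := (quotient_affine e0).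
Local Notation Pi := (holonomy_cover f).
Local Notation V := 'rV[R]_d.
Implicit Types (u v : Pi) (x y : V).

Definition cover_linear u : 'S_d := (qaff (val u)).2.
Definition cover_translation u : V := map_mx intr (qaff (val u)).1.
Definition cover_apply u x : V := col_perm (cover_linear u) x + cover_translation u.

Lemma cover_apply1 x : cover_apply 1%g x = x.
Proof.
rewrite /cover_apply /cover_linear /cover_translation val1 gmult1.
by apply/rowP => e; rewrite !mxE perm1 addr0.
Qed.

Lemma cover_applyM u v x : cover_apply (u * v)%g x = cover_apply u (cover_apply v x).
Proof.
rewrite /cover_apply /cover_linear /cover_translation valM gmulfM.
by apply/rowP => e; rewrite !mxE permM rmorphD /= -addrA [_%:~R + _]addrC.
Qed.

(** Since [u] acts by an isometry, each further application adds at most the displacement of [x]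
    under [u]. *)
Lemma cover_apply_iter u k x :
  `|cover_apply (u ^+ k)%g x - x| <= k%:R * `|cover_apply u x - x|.
Proof.
elim: k => [|k IHk]; first by rewrite expg0 cover_apply1 subrr normr0 mul0r.
rewrite expgS cover_applyM; set y := cover_apply (u ^+ k)%g x in IHk *.
apply: le_trans (ler_distD (cover_apply u x) _ _) _.
rewrite {1}/cover_apply opprD addrACA subrr addr0 -col_permB norm_col_perm.
by rewrite -natr1 mulrDl mul1r lerD2r.
Qed.

Lemma cover_apply_lattice u (v : 'rV[int]_d) x : qaff (val u) = ((v *+ 2)%R, 1%g) ->
  cover_apply u x = x + map_mx intr (v *+ 2).
Proof.
move=> uv; rewrite /cover_apply /cover_linear /cover_translation uv.
by apply/rowP => e; rewrite !mxE perm1.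
Qed.

Lemma cardH_inv_gt0 : 0 < #|H|%:R^-1 :> R.
Proof. by rewrite invr_gt0 ltr0n -cardsT cardG_gt0. Qed.

(** The power of [u] of exponent |H| is an integral translation of norm less than 1, hence trivial,
    and the cover is torsion free. *)
Lemma cover_displacement u x : `|cover_apply u x - x| < #|H|%:R^-1 -> u = 1%g.
Proof.
have H0 : (0 < #|H|)%N by rewrite -cardsT cardG_gt0.
move=> ux; apply: (cover_torsion_free n3 e0 H2 H0).
have u1 : quotient_perm (val (u ^+ #|H|)%g) = 1%g.
  by rewrite val_coverX gmultX /= holonomy_order.
have [v uv] := pure_quotient_even n3 e0 u1.
apply/val_inj/(quotient_affine_inj n3 (e0 := e0)); rewrite uv val1 gmult1.
congr (_, _); apply/rowP => e.
have := cover_apply_iter u #|H| x;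
  rewrite (cover_apply_lattice _ uv) addrAC subrr add0r.
move=> /le_lt_trans -/(_ 1) lt1.
have {lt1 ux} : `|map_mx intr (v *+ 2) : V| < 1.
  apply: lt1; rewrite -ltr_pdivlMl ?ltr0n // mulr1 //.
move=> /(le_lt_trans (rV_norm_coord _ e)).
rewrite mxE mulmxnE mxE -intr_norm -[ltRHS]/(1%:~R) ltr_int.
rewrite ltr_norml; move: (v ord0 e) => z; rewrite -mulr_natr => z1.
suff: z = 0 by move=> ->.
by clear -z1; lia.
Qed.

Lemma cover_codiameter x : exists u, `|cover_apply u x| <= 2.
Proof.
(* The lattice is 2 Z^d, and x - 2 floor(x/2) lies in [0, 2) in each coordinate. *)
pose v : 'rV[int]_d := \row_e - Num.floor (x ord0 e / 2).
exists (cover_lattice n3 e0 f v);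
  rewrite (cover_apply_lattice _ (cover_latticeE n3 e0 f v)).
apply: rV_norm_le => // e; rewrite !mxE.
have /andP[] := floor_itv (x ord0 e / 2).
rewrite intrB intrN intrD => l1 l2.
by rewrite ler_norml; apply/andP; split; lra.
Qed.

Definition holonomy_cover_action : crystal_action R d :=
  @CrystalAction R d Pi cover_linear cover_translation cover_apply1 cover_applyM
    _ cardH_inv_gt0 cover_displacement 2 cover_codiameter.

End HolonomyCoverAction.

(** * Embedding a finite group in a symmetric group of degree at least 3 *)

Section Cayley.
Local Open Scope group_scope.
Variable H : finGroupType.

Let T := (H * 'I_3)%type.

(** Right multiplication, because products of permutations apply the left factor first. *)
Definition cayley_map (h : H) (i : 'I_#|{: T}|) : 'I_#|{: T}| :=
  enum_rank ((enum_val i).1 * h, (enum_val i).2).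

Lemma cayley_map_inj h : injective (cayley_map h).
Proof.
move=> i j /enum_rank_inj [/mulIg E1 E2]; apply: enum_val_inj.
by rewrite [LHS]surjective_pairing E1 E2 -surjective_pairing.
Qed.

Definition cayley (h : H) : 'S_#|{: T}| := perm (@cayley_map_inj h).

Fact cayleyM : {morph cayley : g h / g * h}.
Proof.
by move=> g h; apply/permP => i;
  rewrite permM !permE /cayley_map enum_rankK mulgA.
Qed.
HB.instance Definition _ := isMultiplicative.Build H 'S_#|{: T}| cayley cayleyM.

(* The factor 'I_3 only serves to make the degree at least 3. *)
Lemma cayley_embedding : exists2 n, (3 <= n)%N &
  exists f : {multiplicative H -> 'S_n}, injective f.
Proof.
exists #|{: T}|.
  by rewrite card_prod card_ord leq_pmull // -cardsT cardG_gt0.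
exists cayley => g h /permP/(_ (enum_rank (1, ord0))).
by rewrite !permE /cayley_map enum_rankK !mul1g => /enum_rank_inj [].
Qed.

End Cayley.

Theorem theorem16 (R : realType) (H : finGroupType)
    (H2 : (2.-group [set: H]%SET)%g) :
  (exists (d : nat) (M : closed_riemannian R d), flat M /\ holonomy_group M H) /\
  (forall n : nat, (3 <= n)%N ->
    (exists f : {multiplicative H -> 'S_n}, injective f) ->
    exists M : closed_riemannian R (n * (n - 1) %/ 2),
      [/\ flat M, holonomy_group M H &
          pi1_embeds M (group_quotient (commutator_subgroup (pure_braid n)))]).
Proof.
have main n : (3 <= n)%N -> (exists f : {multiplicative H -> 'S_n}, injective f) ->
    exists M : closed_riemannian R (n * (n - 1) %/ 2),
      [/\ flat M, holonomy_group M H &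
          pi1_embeds M (group_quotient (commutator_subgroup (pure_braid n)))].
  move=> n3 [f f_inj].
  (* Any pair of strands provides the default edge; here it is {0, 1}. *)
  have [|e0 _] := @pair_set_surj n [set Ordinal (ltnW (ltnW n3)); Ordinal (ltnW n3)]%SET.
    by rewrite cards2.
  pose A := holonomy_cover_action R n3 e0 f H2.
  exists (flat_orbit_manifold A); split; first exact: flat_orbit_manifold_flat.
    exists (base A), (acting A); split; first exact: orbit_space_pi1.
    exact: (holonomy_cover_bieberbach n3 e0 f_inj H2).
  exists (base A), (acting A); split; first exact: orbit_space_pi1.
  exists (val : holonomy_cover f -> _); exact: val_inj.
split=> //.
have [n n3 embed] := cayley_embedding H.
by have [M [Mflat MH _]] := main n n3 embed; exists (n * (n - 1) %/ 2), M.
Qed.
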